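(* Let $1<p<\infty$ and $\tau_p:=\left|\frac12-\frac1p\right|$. Let $(\mathcal M,\Sigma,\mu)$ be a $\sigma$-finite measure space and let $T$ be a strongly Kreiss bounded operator on $L^p(\mathcal M)=L^p(\mathcal M,\Sigma,\mu)$, with strong Kreiss constant $C_{SK}$. Then there exist constants $C,\kappa>0$, depending only on $p$ and $C_{SK}$, such that for every integer $N\ge 1$, $$\|T^N\|\le C\,N^{\tau_p}\,\log^{\kappa}(N+1).$$
   Context: Banach spaces are complex. A bounded linear operator $T$ on a Banach space $X$ is called strongly Kreiss bounded if $\sigma(T)\subset\overline{\mathbb D}$ (the closed unit disk) and there is $C>0$ such that $\|(\lambda-T)^{-k}\|\le \frac{C}{(|\lambda|-1)^k}$ for all $\lambda\in\mathbb C$ with $|\lambda|>1$ and all integers $k\ge1$. The smallest such constant $C$ is denoted $C_{SK}$; equivalently, $C_{SK}$ is the smallest $L>0$ with $\|e^{zT}\|\le L e^{|z|}$ for all $z\in\mathbb C$. Here $\log^\kappa(x)$ means $(\log x)^\kappa$. *)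

(* Defs.v *)
From HB Require Import structures.
From mathcomp Require Import all_boot all_order all_algebra.
From mathcomp Require Import generic_quotient ring_quotient complex.
From mathcomp Require Import all_classical all_reals all_analysis.
From mathcomp Require Import measurable_realfun.

Set Implicit Arguments.
Unset Strict Implicit.
Unset Printing Implicit Defensive.

Import Order.TTheory GRing.Theory Num.Theory.
Import numFieldNormedType.Exports.
Import complex.ComplexField.

Local Open Scope classical_set_scope.
Local Open Scope ring_scope.
Local Open Scope complex_scope.
Local Open Scope quotient_scope.

(* A norm over R[i] takes its values in R[i]; [rnorm] is the same norm with
   values in R.  On R[i] itself it is the modulus. *)
Definition rnorm (R : realType) (V : normedZmodType R[i]) (x : V) : R :=
  complex.Re `|x|.

Section rnorm_theory.
Context {R : realType} {V : normedZmodType R[i]}.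
Implicit Types x y : V.

Lemma rnormE x : (rnorm x)%:C = `|x|.
Proof. by rewrite /rnorm RRe_real// normr_real. Qed.

Lemma rnorm_ge0 x : 0 <= rnorm x.
Proof. by rewrite -lecR rnormE normr_ge0. Qed.

Lemma ler_rnormD x y : rnorm (x + y) <= rnorm x + rnorm y.
Proof. by rewrite -lecR rmorphD/= !rnormE ler_normD. Qed.

Lemma rnorm0 : rnorm (0 : V) = 0.
Proof. by rewrite /rnorm normr0. Qed.

Lemma rnorm0_eq0 x : rnorm x = 0 -> x = 0.
Proof. by move=> x0; apply/normr0_eq0; rewrite -rnormE x0. Qed.

End rnorm_theory.

Lemma rnormM (R : realType) (x y : R[i]) :
  rnorm (x * y) = rnorm x * rnorm y.
Proof. by apply: complexI; rewrite rmorphM/= !rnormE normrM. Qed.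

Lemma rnorm_sqrt (R : realType) (z : R[i]) :
  rnorm z = Num.sqrt (complex.Re z ^+ 2 + complex.Im z ^+ 2).
Proof. by rewrite /rnorm normc_def. Qed.

Section operators.
Context {R : realType} {V : normedModType R[i]}.
Implicit Types (T S : V -> V) (l : R[i]).

Definition bounded_operator T : Prop :=
  linear T /\ exists M : R, forall x, rnorm (T x) <= M * rnorm x.

(* To be used on bounded operators only: elsewhere the supremum is a dummy
   value. *)
Definition opnorm T : R := sup [set rnorm (T x) | x in [set x | rnorm x <= 1]].

Definition is_resolvent T l S : Prop :=
  [/\ bounded_operator S,
      forall x, S (l *: x - T x) = x &
      forall x, l *: S x - T (S x) = x].

Definition spectrum T : set R[i] := [set l | ~ exists S, is_resolvent T l S].

(* (l - T)^-1, for l outside of the spectrum; a dummy value otherwise. *)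
Definition resolvent T l : V -> V := get (is_resolvent T l).

Definition strong_kreiss_bound T (C : R) : Prop :=
  forall l k, 1 < rnorm l -> (1 <= k)%N ->
    opnorm (iter k (resolvent T l)) <= C / (rnorm l - 1) ^+ k.

Definition strongly_kreiss_bounded T : Prop :=
  spectrum T `<=` [set l | rnorm l <= 1] /\
  exists2 C : R, 0 < C & strong_kreiss_bound T C.

(* For T strongly Kreiss bounded, the infimum is attained, except when V = 0,
   where it is 0. *)
Definition strong_kreiss_constant T : R :=
  inf [set C | 0 < C /\ strong_kreiss_bound T C].

End operators.

(* The library's Lp spaces consist of real-valued functions, so the complex
   ones are built here. *)
Section complex_Lfun.
Context d (T : measurableType d) (R : realType).

Definition cmeasurable (f : T -> R[i]) : Prop :=
  measurable_fun setT (fun x => complex.Re (f x)) /\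
  measurable_fun setT (fun x => complex.Im (f x)).

Lemma measurable_rnorm (f : T -> R[i]) :
  cmeasurable f -> measurable_fun setT (fun x => rnorm (f x)).
Proof.
move=> [mRe mIm].
rewrite (_ : (fun x => _) = @Num.sqrt R \o
  (fun x => complex.Re (f x) ^+ 2 + complex.Im (f x) ^+ 2)); last first.
  by apply/funext => x /=; rewrite rnorm_sqrt.
apply: measurableT_comp.
  exact: continuous_measurable_fun (@sqrt_continuous R).
by apply: measurable_funD; exact: measurable_funX.
Qed.

Lemma cmeasurable0 : cmeasurable (0 : T -> R[i]).
Proof. by split; exact: measurable_cst. Qed.

Lemma cmeasurableD (f g : T -> R[i]) :
  cmeasurable f -> cmeasurable g -> cmeasurable (f + g).
Proof.
move=> [fr fi] [gr gi]; split.
- rewrite (_ : (fun x => _) =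
    (fun x => complex.Re (f x)) \+ (fun x => complex.Re (g x))).
    exact: measurable_funD.
  by apply/funext => x /=; rewrite fctE; case: (f x) (g x) => ? ? [].
- rewrite (_ : (fun x => _) =
    (fun x => complex.Im (f x)) \+ (fun x => complex.Im (g x))).
    exact: measurable_funD.
  by apply/funext => x /=; rewrite fctE; case: (f x) (g x) => ? ? [].
Qed.

Lemma cmeasurableZ (a : R[i]) (f : T -> R[i]) :
  cmeasurable f -> cmeasurable (a *: f).
Proof.
case: a => a b [fr fi]; split.
- rewrite (_ : (fun x => _) =
    (fun x => a * complex.Re (f x)) \- (fun x => b * complex.Im (f x))).
    by apply: measurable_funB; exact: measurable_funM.
  by apply/funext => x /=; rewrite fctE; case: (f x).
- rewrite (_ : (fun x => _) =
    (fun x => a * complex.Im (f x)) \+ (fun x => b * complex.Re (f x))).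
    by apply: measurable_funD; exact: measurable_funM.
  by apply/funext => x /=; rewrite fctE; case: (f x).
Qed.

Variable mu : {measure set T -> \bar R}.

Definition cLnorm (p : R) (f : T -> R[i]) : \bar R :=
  Lnorm mu p%:E (fun x => (rnorm (f x))%:E).

Lemma eq_cLnorm (p : R) (f g : T -> R[i]) : cmeasurable f -> cmeasurable g ->
  f = g %[ae mu] -> cLnorm p f = cLnorm p g.
Proof.
move=> mf mg fg; rewrite /cLnorm unlock; congr (_ `^ _)%E.
apply: ae_eq_integral => //.
- apply: (measurableT_comp (measurable_poweR _)).
  by do 2 apply: measurableT_comp => //; exact: measurable_rnorm.
- apply: (measurableT_comp (measurable_poweR _)).
  by do 2 apply: measurableT_comp => //; exact: measurable_rnorm.
- by apply: filterS fg => x /= h _; rewrite h.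
Qed.

Variables (p : R) (p1 : 1 <= p).

Let p0 : 0 < p. Proof. exact: lt_le_trans p1. Qed.

Lemma cLnorm0 : cLnorm p 0 = 0%E.
Proof.
rewrite /cLnorm (_ : (fun x => _) = cst 0%E) ?Lnorm0 ?eqe ?gt_eqF//.
by apply/funext => x /=; rewrite rnorm0.
Qed.

Lemma ler_cLnormD (f g : T -> R[i]) : cmeasurable f -> cmeasurable g ->
  (cLnorm p (f + g)%R <= cLnorm p f + cLnorm p g)%E.
Proof.
move=> mf mg.
have := @minkowski_EFin _ _ _ mu _ _ p
  (measurable_rnorm mf) (measurable_rnorm mg) p1.
apply: le_trans; rewrite /cLnorm unlock.
have pV0 : 0 <= p^-1 by rewrite invr_ge0 ltW.
apply: (gt0_ler_poweR pV0).
- by rewrite in_itv/= leey andbT; apply: integral_ge0 => x _; rewrite lee_fin powR_ge0.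
- by rewrite in_itv/= leey andbT; apply: integral_ge0 => x _; rewrite lee_fin powR_ge0.
apply: ge0_le_integral => //.
- by move=> x _; exact: poweR_ge0.
- apply: (measurableT_comp (measurable_poweR _)).
  do 2 apply: measurableT_comp => //; apply: measurable_rnorm.
  exact: cmeasurableD.
- apply: (measurableT_comp (measurable_poweR _)).
  do 2 apply: measurableT_comp => //.
  by apply: measurable_funD; exact: measurable_rnorm.
- move=> x _; rewrite /= lee_fin ge0_ler_powR ?nnegrE ?(ltW p0)//.
  by rewrite !ger0_norm ?rnorm_ge0 ?addr_ge0 ?rnorm_ge0// ler_rnormD.
Qed.

Lemma cLnormZ (a : R[i]) (f : T -> R[i]) : cmeasurable f ->
  (cLnorm p (a *: f)%R = (rnorm a)%:E * cLnorm p f)%E.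
Proof.
move=> mf; rewrite /cLnorm unlock.
under eq_integral => x _.
  rewrite fctE rnormM EFinM abseM poweRM// gee0_abs ?lee_fin ?rnorm_ge0//.
  rewrite poweR_EFin; over.
rewrite ge0_integralZl_EFin ?powR_ge0//; last 2 first.
- by move=> x _; exact: poweR_ge0.
- apply: (measurableT_comp (measurable_poweR _)).
  by do 2 apply: measurableT_comp => //; exact: measurable_rnorm.
rewrite poweRM ?lee_fin ?powR_ge0//; last first.
  by apply: integral_ge0 => x _; exact: poweR_ge0.
by rewrite poweR_EFin -powRrM mulfV ?gt_eqF// powRr1// rnorm_ge0.
Qed.

Lemma cLnorm_eq0 (f : T -> R[i]) : cmeasurable f ->
  cLnorm p f = 0%E -> f = 0 %[ae mu].
Proof.
move=> mf /Lnorm_eq0_eq0 h.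
have {h} : (fun x => (rnorm (f x))%:E) = \0%E %[ae mu].
  by apply: h; [apply/measurable_EFinP; exact: measurable_rnorm|rewrite lte_fin].
by apply: filterS => x /(_ I) [/rnorm0_eq0].
Qed.

Definition cLfun : {pred T -> R[i]} :=
  [pred f | `[< cmeasurable f /\ (cLnorm p f < +oo)%E >]].

Lemma cLfun_submod_closed : submod_closed cLfun.
Proof.
split.
  by apply/asboolP; split; [exact: cmeasurable0|rewrite cLnorm0].
move=> a f g /asboolP[mf lf] /asboolP[mg lg]; apply/asboolP; split.
  by apply: cmeasurableD => //; exact: cmeasurableZ.
apply: le_lt_trans (ler_cLnormD (cmeasurableZ a mf) mg) _.
by rewrite lte_add_pinfty// cLnormZ// lte_mul_pinfty// lee_fin rnorm_ge0.
Qed.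

End complex_Lfun.

(* Representatives: p-integrable functions, not yet identified when they are
   a.e. equal.  The proof of 1 <= p, although not used in the fields, is a
   parameter because the vector space structure depends on it. *)
Record cLfunType d (T : measurableType d) (R : realType)
    (mu : {measure set T -> \bar R}) (p : R) (p1 : 1 <= p) := CLfunType {
  cLfun_val :> T -> R[i] ; _ : cLfun_val \in cLfun mu p }.

Section cLfunType.
Context d (T : measurableType d) (R : realType).
Variables (mu : {measure set T -> \bar R}) (p : R) (p1 : 1 <= p).

HB.instance Definition _ := GRing.isSubmodClosed.Build R[i] (T -> R[i])
  (cLfun mu p) (cLfun_submod_closed mu p1).

HB.instance Definition _ := [isSub for @cLfun_val _ _ _ mu p p1].
HB.instance Definition _ := [Choice of cLfunType mu p1 by <:].
HB.instance Definition _ := [SubChoice_isSubLmodule of cLfunType mu p1 by <:].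

Implicit Types f g : cLfunType mu p1.

Lemma cLfun_measurable f : cmeasurable f.
Proof. by have /asboolP[] := valP f. Qed.

Lemma cLnorm_lty f : (cLnorm mu p f < +oo)%E.
Proof. by have /asboolP[] := valP f. Qed.

Lemma cLnorm_fineK f : (fine (cLnorm mu p f))%:E = cLnorm mu p f.
Proof. by rewrite fineK// ge0_fin_numE ?cLnorm_lty// Lnorm_ge0. Qed.

Definition cLnull : {pred cLfunType mu p1} :=
  [pred f : cLfunType mu p1 | `[< (f : T -> R[i]) = 0 %[ae mu] >]].

Lemma cLnull_submod_closed : submod_closed cLnull.
Proof.
split; first by apply/asboolP; exact: ae_eq_refl.
move=> a f g /asboolP f0 /asboolP g0; apply/asboolP.
near=> x => _.
have fx : (f : T -> R[i]) x = 0 by near: x; apply: filterS f0 => y; exact.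
have gx : (g : T -> R[i]) x = 0 by near: x; apply: filterS g0 => y; exact.
rewrite (_ : (_ : T -> R[i]) x = a * (f : T -> R[i]) x + (g : T -> R[i]) x)//.
by rewrite fx gx mulr0 addr0.
Unshelve. all: by end_near. Qed.

HB.instance Definition _ := GRing.isSubmodClosed.Build R[i] (cLfunType mu p1)
  cLnull cLnull_submod_closed.

(* The Banach space L^p(T, mu) of complex-valued functions *)
Definition Lp : Type := Quotient.quot cLnull.

HB.instance Definition _ := EqQuotient.on Lp.
HB.instance Definition _ := Choice.on Lp.
HB.instance Definition _ := GRing.Zmodule.on Lp.
HB.instance Definition _ := ZmodQuotient.on Lp.

Lemma Lp_eqP f g :
  reflect ((f : T -> R[i]) = g %[ae mu]) (\pi_Lp f == \pi_Lp g).
Proof.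
rewrite -Quotient.idealrBE; apply: (iffP (asboolP _)); apply: filterS => x h.
  by move=> /h fg; apply/eqP; rewrite -subr_eq0; apply/eqP; exact: fg.
move=> /h fg; rewrite (_ : (_ : T -> R[i]) x = f x - g x)//.
by rewrite fg subrr.
Qed.

Definition Lp_scale (a : R[i]) (u : Lp) : Lp := \pi_Lp (a *: repr u).

Lemma Lp_scale_pi a f : Lp_scale a (\pi_Lp f) = \pi_Lp (a *: f).
Proof.
apply/eqP; rewrite /Lp_scale -Quotient.idealrBE -scalerBr rpredZ//.
by rewrite Quotient.idealrBE reprK.
Qed.

Lemma Lp_scaleA a b u : Lp_scale a (Lp_scale b u) = Lp_scale (a * b) u.
Proof. by elim/quotW: u => f; rewrite (Lp_scale_pi b) !Lp_scale_pi scalerA. Qed.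

Lemma Lp_scale1 : left_id 1 Lp_scale.
Proof. by elim/quotW => f; rewrite Lp_scale_pi scale1r. Qed.

Lemma Lp_scaleDr : right_distributive Lp_scale +%R.
Proof.
move=> a; elim/quotW => f; elim/quotW => g.
by rewrite -raddfD !Lp_scale_pi scalerDr raddfD.
Qed.

Lemma Lp_scaleDl u : {morph Lp_scale^~ u : a b / a + b}.
Proof.
by move=> a b; elim/quotW: u => f; rewrite !Lp_scale_pi scalerDl raddfD.
Qed.

HB.instance Definition _ := GRing.Zmodule_isLmodule.Build R[i] Lp
  Lp_scaleA Lp_scale1 Lp_scaleDr Lp_scaleDl.

(* The library wants the norm to take its values in the field of scalars. *)
Definition Lp_norm (u : Lp) : R[i] := (fine (cLnorm mu p (repr u)))%:C.

Lemma Lp_norm_pi f : Lp_norm (\pi_Lp f) = (fine (cLnorm mu p f))%:C.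
Proof.
congr (fine _)%:C; apply: eq_cLnorm; [exact: cLfun_measurable..|].
by apply/Lp_eqP; rewrite reprK.
Qed.

Lemma ler_Lp_normD u v : Lp_norm (u + v) <= Lp_norm u + Lp_norm v.
Proof.
elim/quotW: u => f; elim/quotW: v => g.
rewrite -raddfD !Lp_norm_pi -rmorphD/= lecR -lee_fin EFinD (cLnorm_fineK (f + g)) !cLnorm_fineK.
by apply: ler_cLnormD => //; exact: cLfun_measurable.
Qed.

Lemma Lp_normZ a u : Lp_norm (a *: u) = `|a| * Lp_norm u.
Proof.
elim/quotW: u => f; rewrite [_ *: _]Lp_scale_pi !Lp_norm_pi.
rewrite cLnormZ ?fineM ?rmorphM/= ?rnormE//.
- by rewrite -cLnorm_fineK.
- exact: cLfun_measurable.
Qed.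

Lemma Lp_norm_eq0 u : Lp_norm u = 0 -> u = 0.
Proof.
elim/quotW: u => f; rewrite Lp_norm_pi => -[] f0.
have : cLnorm mu p f = 0%E by rewrite -cLnorm_fineK f0.
move=> /(cLnorm_eq0 p1 (cLfun_measurable f)) {}f0.
by rewrite -(raddf0 \pi_Lp); apply/eqP/Lp_eqP.
Qed.

HB.instance Definition _ := Lmodule_isNormed.Build R[i] Lp
  ler_Lp_normD Lp_normZ Lp_norm_eq0.

Lemma rnorm_pi f : (rnorm (\pi_Lp f))%:E = cLnorm mu p f.
Proof. by rewrite -cLnorm_fineK /rnorm [`|_|]Lp_norm_pi. Qed.

End cLfunType.

Arguments Lp {d T R} mu {p} p1.

(* Main.v *)
(* Estimates at scale N are deduced from estimates at scale sqrt N.  By the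
   bounds on (l - T)^-k with |l| = a + 1, a large, k = a g, the operators
   sum_i G_i z^i T^i, |z| = 1, have norm at most 2L when G is a (truncated)
   negative binomial law, which is concentrated on a window of width O(sqrt g)
   about g.  Multiplying by the polynomials G thus moves a polynomial b whose
   coefficients fill a window of length ~ sqrt N to all windows of that length
   near N, at a cost 2L.  These ~ sqrt N frequency windows are glued with tents,
   i.e. with modulated Fejer kernels kappa chi_k.  As kappa is a probability for
   which the chi_k are orthonormal, the cost of gluing is that of
   Hausdorff-Young: if s = max(1/p, 1 - 1/p), it multiplies the norm of
   x |-> (b(zT)x)_z from L^p to L^p(z; L^p), and that of the dual kind of map
   f |-> sum_z b(zT)f(z), by (sqrt N)^s.  After log log N steps these norms are
   N^s (log N)^kappa.  Finally the coefficient of T^N in b G b, with b of length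
   ~ sqrt N, gives sqrt N |T^N| <= 2L (sqrt N)^(2s) (log N)^kappa, and
   s - 1/2 = |1/2 - 1/p|.  Everything takes place on the group of D-th roots of
   unity z, with D large. *)
From HB Require Import structures.
From mathcomp Require Import all_boot all_order all_algebra.
From mathcomp Require Import complex separable cyclotomic.
From mathcomp Require Import all_classical all_reals all_analysis.
From mathcomp Require Import measurable_realfun ring lra zify.
Require Import Defs.

Set Implicit Arguments.
Unset Strict Implicit.
Unset Printing Implicit Defensive.

Import Order.TTheory GRing.Theory Num.Theory.
Import numFieldNormedType.Exports.
Import complex.ComplexField.

Local Open Scope ring_scope.

(** * Power means of finite sums *)

Lemma ler_eq (R : numDomainType) (x y : R) : x = y -> x <= y.
Proof. by move=> ->. Qed.

(** Young's inequality suffices: with y the mean, y^p = sum_i w_i x_i y^(p-1) is at most (sum_i w_i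
    x_i^p)/p + y^p/q, and the last term is absorbed on the left. *)
Lemma powR_sum_jensen (R : realType) (I : finType) (w x : I -> R) (p : R) : 1 < p ->
  (forall i, 0 <= w i) -> \sum_i w i = 1 -> (forall i, 0 <= x i) ->
  (\sum_i w i * x i) `^ p <= \sum_i w i * x i `^ p.
Proof.
move=> p1 w0 w1 x0.
have p0 : 0 < p by lra.
set y := \sum_i w i * x i.
have y0 : 0 <= y by apply: sumr_ge0 => i _; rewrite mulr_ge0.
pose q := p / (p - 1).
have q0 : 0 < q by rewrite divr_gt0//; lra.
have pq : p^-1 + q^-1 = 1 by rewrite /q; field; apply/andP; split; lra.
have yq : (y `^ (p - 1)) `^ q = y `^ p.
  by rewrite -powRrM /q; congr (_ `^ _); field; lra.
have : y `^ p <= (\sum_i w i * x i `^ p) / p + y `^ p / q.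
  have -> : y `^ p / q = \sum_i w i * (y `^ p / q) by rewrite -mulr_suml w1 mul1r.
  rewrite -{1}(mulr_powRB1 y0 p0) {1}/y !mulr_suml -big_split.
  apply: ler_sum => i _ /=.
  rewrite -!mulrA -mulrDr ler_wpM2l// -yq.
  by apply: conjugate_powR => //; rewrite powR_ge0.
rewrite -subr_ge0 => h; rewrite -subr_ge0.
have -> : \sum_i w i * x i `^ p - y `^ p =
  p * ((\sum_i w i * x i `^ p) / p + y `^ p / q - y `^ p).
  have -> : q^-1 = 1 - p^-1 by rewrite -pq; ring.
  by field; lra.
by rewrite mulr_ge0// ltW.
Qed.

Lemma powR_sum_le (R : realType) (I : finType) (x : I -> R) (p : R) : 1 <= p ->
  (forall i, 0 <= x i) -> (\sum_i x i) `^ p <= #|I|%:R `^ (p - 1) * \sum_i x i `^ p.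
Proof.
rewrite le_eqVlt => /predU1P[<-|p1] x0.
  rewrite subrr powRr0 mul1r powRr1 ?sumr_ge0//.
  by apply: ler_sum => i _; rewrite powRr1.
have p0 : 0 < p by lra.
have [I0|I0] := posnP #|I|.
  have e (F : I -> R) : \sum_i F i = 0.
    by rewrite big1// => i _; have := card0_eq I0 i.
  by rewrite !e mulr0 powR0// gt_eqF.
have n0 : 0 < #|I|%:R :> R by rewrite ltr0n.
have w1 : \sum_(i : I) (#|I|%:R^-1 : R) = 1.
  by rewrite sumr_const -(mulr_natr (#|I|%:R^-1)) mulVf ?gt_eqF.
have w0 : forall i : I, 0 <= #|I|%:R^-1 :> R by move=> i; rewrite invr_ge0 ltW.
have := powR_sum_jensen p1 w0 w1 x0; rewrite -!mulr_sumr.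
rewrite powRM ?invr_ge0 ?(ltW n0) ?sumr_ge0// => h.
rewrite -(@ler_pM2l _ (#|I|%:R^-1 `^ p)); last by rewrite powR_gt0// invr_gt0.
apply: le_trans h _; rewrite mulrA ler_wpM2r ?sumr_ge0//.
  by move=> i _; rewrite powR_ge0.
rewrite -powR_inv1 ?(ltW n0)// -powRrM -powRD; last by apply/implyP => _; rewrite gt_eqF.
by rewrite (_ : -1 * p + (p - 1) = -1)//; ring.
Qed.

(** After division by the sum, each nonzero term lies in ]0, 1], where t <= t^r. *)
Lemma powR_sum_ge (R : realType) (I : finType) (x : I -> R) (r : R) : 0 < r -> r <= 1 ->
  (forall i, 0 <= x i) -> (\sum_i x i) `^ r <= \sum_i x i `^ r.
Proof.
move=> r0 r1 x0.
have [S0|S0] := leP (\sum_i x i) 0.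
  have -> : \sum_i x i = 0 by apply/eqP; rewrite eq_le S0 sumr_ge0.
  by rewrite powR0 ?gt_eqF// sumr_ge0// => i _; rewrite powR_ge0.
set S := \sum_i x i in S0 *.
have -> : S `^ r = \sum_i x i / S * S `^ r.
  by rewrite -!mulr_suml divff ?mul1r// gt_eqF.
apply: ler_sum => i _.
have [xi0|xi0] := eqVneq (x i) 0; first by rewrite xi0 !mul0r powR_ge0.
have xp : 0 < x i by rewrite lt_neqAle eq_sym xi0/=.
have -> : x i `^ r = (x i / S) `^ r * S `^ r.
  by rewrite -powRM ?divr_ge0 ?(ltW S0)// divfK// gt_eqF.
rewrite ler_pM2r ?powR_gt0//; apply: ger1_powR => //.
rewrite divr_gt0//= ler_pdivrMr// mul1r.
by rewrite /S (bigD1 i)//= lerDl sumr_ge0.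
Qed.

(** * Orthonormal unimodular functions in finite L^p *)

Section rnorm_extra.
Context {R : realType}.
Implicit Types (a : R[i]).

Lemma rnormZ (V : normedModType R[i]) (a : R[i]) (x : V) :
  rnorm (a *: x) = rnorm a * rnorm x.
Proof. by apply: complexI; rewrite rmorphM/= !rnormE normrZ. Qed.

Lemma ler_rnorm_sum (V : normedZmodType R[i]) (I : Type) (r : seq I) (P : pred I)
  (F : I -> V) : rnorm (\sum_(i <- r | P i) F i) <= \sum_(i <- r | P i) rnorm (F i).
Proof.
elim/big_ind2 : _ => //; first by rewrite rnorm0.
by move=> x a y b xa yb; apply: le_trans (ler_rnormD _ _) _; exact: lerD.
Qed.

Lemma rnorm1 : rnorm (1 : R[i]) = 1.
Proof. by apply: complexI; rewrite rnormE normr1. Qed.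

Lemma rnormX a n : rnorm (a ^+ n) = rnorm a ^+ n.
Proof. by elim: n => [|n IH]; rewrite ?expr0 ?rnorm1// !exprS rnormM IH. Qed.

Lemma rnormV a : rnorm a^-1 = (rnorm a)^-1.
Proof. by apply: complexI; rewrite fmorphV/= !rnormE normfV. Qed.

Lemma rnormN (V : normedZmodType R[i]) (x : V) : rnorm (- x) = rnorm x.
Proof. by apply: complexI; rewrite !rnormE normrN. Qed.

Lemma rnormR (x : R) : 0 <= x -> rnorm (x%:C)%C = x.
Proof. by move=> x0; apply: complexI; rewrite rnormE ger0_norm// ler0c. Qed.

Lemma sqr_rnorm a : ((rnorm a ^+ 2)%:C)%C = a * (a^*)%C.
Proof. by rewrite rmorphXn/= rnormE sqr_normc. Qed.

Lemma unimodular_conj a : rnorm a = 1 -> (a^*)%C = a^-1.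
Proof. by move=> a1; rewrite invc_norm -rnormE a1 expr1n invr1 mul1r. Qed.

Lemma unimodular_neq0 a : rnorm a = 1 -> a != 0.
Proof. by move=> a1; apply/eqP => a0; move: a1; rewrite a0 rnorm0; lra. Qed.

End rnorm_extra.

Section local_inequalities.
Context {R : realType} (J I : finType) (w : J -> R) (chi : I -> J -> R[i]).
Hypothesis w0 : forall j, 0 <= w j.
Hypothesis w1 : \sum_j w j = 1.
Hypothesis chi1 : forall i j, rnorm (chi i j) = 1.
Hypothesis chi_orth : forall i k,
  \sum_j ((w j)%:C)%C * (chi i j * (chi k j)^*%C) = (i == k)%:R.

Lemma local_parseval (c : I -> R[i]) :
  \sum_j w j * rnorm (\sum_i c i * chi i j) ^+ 2 = \sum_i rnorm (c i) ^+ 2.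
Proof.
apply: complexI; rewrite !rmorph_sum/=.
under eq_bigr => j _.
  rewrite rmorphM/= sqr_rnorm rmorph_sum/= big_distrl/=.
  under eq_bigr => i _ do rewrite big_distrr/=.
  rewrite mulr_sumr; under eq_bigr => i _ do rewrite mulr_sumr.
  over.
rewrite exchange_big/=; apply: eq_bigr => i _.
rewrite exchange_big/= (bigD1 i)//=.
have e k : \sum_j ((w j)%:C)%C * (c i * chi i j * (c k * chi k j)^*%C) =
   c i * (c k)^*%C * (i == k)%:R.
  rewrite -chi_orth mulr_sumr; apply: eq_bigr => j _.
  by rewrite rmorphM/=; ring.
rewrite e eqxx mulr1 sqr_rnorm big1 ?addr0// => k ki.
by rewrite e eq_sym (negbTE ki) mulr0.
Qed.

(** An elementary substitute for interpolation between L^2 and L^infinity. For p < 2, Jensen passes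
    from L^p to L^2, Parseval applies, and the power p/2 <= 1 is subadditive. For p >= 2, Parseval
    takes two of the p factors and the other p - 2 are bounded by S = sum_i |c_i|. *)
Lemma local_synthesis (p : R) (c : I -> R[i]) : 1 < p ->
  \sum_j w j * rnorm (\sum_i c i * chi i j) `^ p <=
  #|I|%:R `^ Num.max 0 (p - 2) * \sum_i rnorm (c i) `^ p.
Proof.
move=> p1; set F := fun j => rnorm (\sum_i c i * chi i j).
have F0 j : 0 <= F j by exact: rnorm_ge0.
have := local_parseval c; rewrite -/(F _) => pars.
have [p2|p2] := ltP p 2.
  rewrite max_l ?powRr0 ?mul1r; last by lra.
  have h : (\sum_j w j * F j `^ p) `^ (2 / p) <= \sum_j w j * F j ^+ 2.
    apply: le_trans (powR_sum_jensen _ w0 w1 _) _.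
    - by rewrite ltr_pdivlMr; lra.
    - by move=> j; rewrite powR_ge0.
    - apply: ler_sum => j _; rewrite -powRrM.
      rewrite (_ : p * (2 / p) = 2%:R); last by field; lra.
      by rewrite powR_mulrn.
  rewrite pars in h.
  have S0 : 0 <= \sum_j w j * F j `^ p.
    by rewrite sumr_ge0// => j _; rewrite mulr_ge0// powR_ge0.
  have -> : \sum_j w j * F j `^ p = ((\sum_j w j * F j `^ p) `^ (2 / p)) `^ (p / 2).
    rewrite -powRrM (_ : 2 / p * (p / 2) = 1) ?powRr1//.
    by field; lra.
  apply: (@le_trans _ _ ((\sum_i rnorm (c i) ^+ 2) `^ (p / 2))).
    apply: ge0_ler_powR => //; rewrite ?nnegrE ?powR_ge0//; first by lra.
    by rewrite sumr_ge0// => i _; rewrite sqr_ge0.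
  apply: le_trans (powR_sum_ge _ _ _) _; [by lra|by lra|by move=> i; rewrite sqr_ge0|].
  apply: ler_sum => i _; rewrite -powR_mulrn ?rnorm_ge0// -powRrM.
  by rewrite (_ : 2%:R * (p / 2) = p)//; field.
rewrite max_r; last by lra.
set S := \sum_i rnorm (c i).
have S0 : 0 <= S by rewrite sumr_ge0// => i _; rewrite rnorm_ge0.
have FS j : F j <= S.
  apply: le_trans (ler_rnorm_sum _ _ _) _.
  by apply: ler_sum => i _; rewrite rnormM chi1 mulr1.
have step1 : \sum_j w j * F j `^ p <= S `^ (p - 2) * \sum_i rnorm (c i) ^+ 2.
  rewrite -pars mulr_sumr; apply: ler_sum => j _.
  rewrite mulrCA ler_wpM2l//.
  have -> : F j `^ p = F j `^ (p - 2) * F j ^+ 2.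
    rewrite -powR_mulrn// -powRD; first by congr (_ `^ _); ring.
    by apply/implyP; rewrite subrK gt_eqF//; lra.
  rewrite ler_wpM2r ?sqr_ge0// ge0_ler_powR ?nnegrE//; lra.
apply: le_trans step1 _.
have [I0|I0] := posnP #|I|.
  have e (G : I -> R) : \sum_i G i = 0.
    by rewrite big1// => i _; have := card0_eq I0 i.
  by rewrite !e !mulr0.
have n0 : 0 < #|I|%:R :> R by rewrite ltr0n.
move: p2; rewrite le_eqVlt => /predU1P[p2|p2].
  rewrite -p2 subrr !powRr0 !mul1r.
  by apply: ler_sum => i _; rewrite powR_mulrn ?rnorm_ge0.
(* With m the mean of the |c_i|, S^(p-2) is #|I|^(p-2) m^(p-2). Young's inequality for m^(p-2)
   |c_i|^2 and the convexity bound #|I| m^p <= sum_i |c_i|^p finish the case p > 2. *)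
set m := S / #|I|%:R.
have m0 : 0 <= m by rewrite divr_ge0// ltW.
have -> : S = #|I|%:R * m by rewrite /m mulrCA divff ?mulr1 ?gt_eqF.
rewrite powRM// ?(ltW n0)// -mulrA ler_wpM2l ?powR_ge0//.
have mS : #|I|%:R * m `^ p <= \sum_i rnorm (c i) `^ p.
  rewrite /m powRM ?invr_ge0 ?(ltW n0)//.
  have := @powR_sum_le R I (fun i => rnorm (c i)) p (ltW p1) (fun i => rnorm_ge0 _).
  rewrite -/S => hS; rewrite mulrCA.
  apply: le_trans (ler_wpM2r _ hS) _; first by rewrite mulr_ge0 ?powR_ge0// ltW.
  rewrite mulrAC -[leRHS]mul1r ler_wpM2r ?sumr_ge0//.
    by move=> i _; rewrite powR_ge0.
  rewrite -powR_inv1 ?(ltW n0)// -powRrM mulN1r powRN.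
  rewrite mulrA [X in X * _ <= _]mulrC mulr_powRB1 ?(ltW n0)//; last by lra.
  by rewrite divff// gt_eqF// powR_gt0.
have young i : m `^ (p - 2) * rnorm (c i) ^+ 2 <=
   (p - 2) / p * m `^ p + 2 / p * rnorm (c i) `^ p.
  have := @conjugate_powR R (m `^ (p - 2)) (rnorm (c i) ^+ 2) (p / (p - 2)) (p / 2).
  move=> /(_ (powR_ge0 _ _) (sqr_ge0 _)) h.
  apply: le_trans (h _ _ _) _.
  - by rewrite divr_gt0//; lra.
  - by rewrite divr_gt0//; lra.
  - by field; apply/andP; split; lra.
  rewrite -powR_mulrn ?rnorm_ge0// -!powRrM.
  rewrite (_ : (p - 2) * (p / (p - 2)) = p); last by field; lra.
  rewrite (_ : 2%:R * (p / 2) = p); last by field.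
  by rewrite !invf_div mulrC [X in _ + X]mulrC.
rewrite mulr_sumr; apply: le_trans (ler_sum _ (fun i _ => young i)) _.
rewrite big_split/= sumr_const -(mulr_natr (_ * m `^ p)) -[X in _ + X <= _]mulr_sumr.
set T := \sum_i _ in mS *.
have : (p - 2) / p * (#|I|%:R * m `^ p) <= (p - 2) / p * T.
  by rewrite ler_wpM2l// divr_ge0//; lra.
move=> h; apply: le_trans (lerD (_ : _ <= (p - 2) / p * T) (lexx _)) _.
  by apply: le_trans h; apply: ler_eq; ring.
rewrite -mulrDl (_ : (p - 2) / p + 2 / p = 1) ?mul1r//.
by field; lra.
Qed.

(** Dual to [local_synthesis] at the conjugate exponent [q]: the left side is the pairing of [g]
    with a function [h] synthesized from the extremal dual vector. *)
Lemma local_analysis (p : R) (g : J -> R[i]) : 1 < p ->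
  \sum_i rnorm (\sum_j ((w j)%:C)%C * (chi i j * g j)) `^ p <=
  #|I|%:R `^ Num.max 0 (2 - p) * \sum_j w j * rnorm (g j) `^ p.
Proof.
move=> p1.
set c := fun i => \sum_j ((w j)%:C)%C * (chi i j * g j).
pose q := p / (p - 1).
have p0 : 0 < p by lra.
have q1 : 1 < q by rewrite /q ltr_pdivlMr; lra.
have pq : p^-1 + q^-1 = 1 by rewrite /q; field; apply/andP; split; lra.
(* The extremal dual vector: u_i c_i = |c_i|^p, and |u_i|^q = |c_i|^p. *)
pose u i : R[i] := if c i == 0 then 0 else
  ((rnorm (c i) `^ (p - 1))%:C)%C * ((rnorm (c i))%:C / c i)%C.
have rc0 i : c i != 0 -> 0 < rnorm (c i).
  move=> ci0; rewrite lt_neqAle rnorm_ge0 andbT eq_sym.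
  by apply: contra_neq ci0; exact: rnorm0_eq0.
have ru i : rnorm (u i) = rnorm (c i) `^ (p - 1).
  rewrite /u; case: eqVneq => [->|ci0].
    by rewrite !rnorm0 powR0// gt_eqF//; lra.
  rewrite rnormM rnormR ?powR_ge0// rnormM rnormR ?rnorm_ge0// rnormV.
  by rewrite divff ?mulr1// gt_eqF// rc0.
have uc i : u i * c i = ((rnorm (c i) `^ p)%:C)%C.
  rewrite /u; case: eqVneq => [->|ci0]; first by rewrite rnorm0 powR0 ?mulr0// gt_eqF.
  by rewrite -mulrA divfK// -rmorphM/= mulrC mulr_powRB1// rnorm_ge0.
set S := \sum_i rnorm (c i) `^ p.
have S0 : 0 <= S by rewrite sumr_ge0// => i _; rewrite powR_ge0.
set h := fun j => \sum_i u i * chi i j.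
have hq : \sum_j w j * rnorm (h j) `^ q <= #|I|%:R `^ Num.max 0 (q - 2) * S.
  apply: le_trans (local_synthesis _ q1) _; rewrite ler_wpM2l ?powR_ge0//.
  apply: ler_sum => i _; rewrite ru -powRrM (_ : (p - 1) * q = p)//.
  by rewrite /q; field; lra.
have [I0|I0] := posnP #|I|.
  rewrite /S big1; last by move=> i _; have := card0_eq I0 i.
  rewrite mulr_ge0 ?powR_ge0 ?sumr_ge0// => j _.
  by rewrite mulr_ge0 ?powR_ge0.
have n0 : 0 < #|I|%:R :> R by rewrite ltr0n.
set E := #|I|%:R `^ Num.max 0 (q - 2) in hq.
have E0 : 0 < E by rewrite powR_gt0.
have SE : S = rnorm (\sum_j ((w j)%:C)%C * (g j * h j)).
  rewrite -[LHS]rnormR//; congr rnorm; rewrite rmorph_sum/=.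
  under eq_bigr do rewrite -uc /c mulr_sumr.
  rewrite exchange_big/=; apply: eq_bigr => j _.
  rewrite /h 2!mulr_sumr; apply: eq_bigr => i _; ring.
(* The parameter of Young's inequality, tuned so that the part containing [h] is at most S/q and can
   be subtracted from S. *)
pose tau := E `^ q^-1.
have tau0 : 0 < tau by rewrite powR_gt0.
have tauq : tau `^ q = E by rewrite -powRrM mulVf ?powRr1 ?(ltW E0)// gt_eqF//; lra.
have tauN : (tau^-1) `^ q * E = 1.
  by rewrite -tauq -powRM ?invr_ge0 ?(ltW tau0)// mulVf ?powR1// gt_eqF.
have SY : S <= tau `^ p / p * (\sum_j w j * rnorm (g j) `^ p) + S / q.
  apply: (@le_trans _ _ (\sum_j w j * ((tau * rnorm (g j)) * (tau^-1 * rnorm (h j))))).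
    rewrite SE; apply: le_trans (ler_rnorm_sum _ _ _) _; apply: ler_sum => j _.
    rewrite rnormM rnormR// rnormM mulrACA divff ?mul1r// gt_eqF//.
  apply: (@le_trans _ _ (\sum_j w j * (tau `^ p / p * rnorm (g j) `^ p +
      (tau^-1) `^ q / q * rnorm (h j) `^ q))).
    apply: ler_sum => j _; rewrite ler_wpM2l//.
    have := @conjugate_powR R (tau * rnorm (g j)) (tau^-1 * rnorm (h j)) p q.
    rewrite !powRM ?rnorm_ge0 ?invr_ge0 ?(ltW tau0)// => H.
    apply: le_trans (H _ _ _ _ pq) _; rewrite ?mulr_ge0 ?rnorm_ge0 ?invr_ge0 ?(ltW tau0)//.
      by lra.
    by rewrite !(mulrAC _ _ _^-1).
  under eq_bigr do rewrite mulrDr !(mulrCA (w _)).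
  rewrite big_split/= -!mulr_sumr lerD2l.
  rewrite mulrAC ler_wpM2r ?invr_ge0//; first by lra.
  apply: le_trans (ler_wpM2l _ hq) _; first by rewrite powR_ge0.
  by rewrite mulrA tauN mul1r.
(* As p/q = p - 1 and (q - 2)(p - 1) = 2 - p, the constant at [q] turns into the one claimed at
   [p]. *)
have e : tau `^ p = #|I|%:R `^ Num.max 0 (2 - p).
  rewrite /tau /E -!powRrM; congr (_ `^ _).
  have [p2|p2] := leP p 2.
    have q2 : 0 <= q - 2 by rewrite /q subr_ge0 ler_pdivlMr; lra.
    have p2' : 0 <= 2 - p by lra.
    by rewrite (max_r q2) (max_r p2') /q; field; apply/andP; split; lra.
  have q2 : q - 2 <= 0 by rewrite /q subr_le0 ler_pdivrMr; lra.
  have p2' : 2 - p <= 0 by lra.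
  by rewrite (max_l q2) (max_l p2') !mul0r.
rewrite -e.
set G := \sum_j _ in SY *.
have : S / p <= tau `^ p / p * G.
  have Sp : S / p = S - S / q by have -> : p^-1 = 1 - q^-1; [lra|ring].
  by rewrite Sp; lra.
rewrite (_ : tau `^ p / p * G = tau `^ p * G / p); last by ring.
by rewrite ler_pM2r ?invr_gt0.
Qed.

End local_inequalities.

(** * From scalars to L^p *)

(* A finite matrix inequality in l^p between scalars holds verbatim between
   vectors of L^p, by integrating it pointwise. *)
Definition lp_extension (R : realType) (V : normedModType R[i]) (p : R) : Prop :=
  forall (I J : finType) (s : I -> J -> R[i]) (c : R), 0 <= c ->
  (forall z : J -> R[i], \sum_i rnorm (\sum_j s i j * z j) `^ p <=
     c * \sum_j rnorm (z j) `^ p) ->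
  forall f : J -> V, \sum_i rnorm (\sum_j s i j *: f j) `^ p <=
     c * \sum_j rnorm (f j) `^ p.

Section Lp_extension.
Context d (T : measurableType d) (R : realType) (mu : {measure set T -> \bar R}).
Variables (p : R) (p1 : 1 <= p).

Let p0 : 0 < p. Proof. exact: lt_le_trans p1. Qed.

Lemma rnorm_pi_powR (f : cLfunType mu p1) :
  ((rnorm (\pi_(Lp mu p1)%qT f) `^ p)%:E = \int[mu]_x ((rnorm (f x)) `^ p)%:E)%E.
Proof.
rewrite -poweR_EFin rnorm_pi /cLnorm powR_Lnorm ?gt_eqF//.
by apply: eq_integral => x _; rewrite abse_EFin poweR_EFin ger0_norm ?rnorm_ge0.
Qed.

Lemma Lp_lp_extension : lp_extension (Lp mu p1) p.
Proof.
move=> I J s c c0 scal f.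
pose g j : cLfunType mu p1 := repr (f j).
have gE j : f j = \pi_(Lp mu p1)%qT (g j) by rewrite reprK.
have sE i : \sum_j s i j *: f j = \pi_(Lp mu p1)%qT (\sum_j s i j *: g j).
  rewrite raddf_sum; apply: eq_bigr => j _.
  by rewrite gE [LHS]Lp_scale_pi.
have valE i x : (\sum_j s i j *: g j : cLfunType mu p1) x = \sum_j s i j * g j x.
  rewrite -[LHS]/((cLfun_val _) x).
  elim/big_rec2 : _ => [//|j y1 y2 _ <-] //.
have mg (h : cLfunType mu p1) : measurable_fun setT (EFin \o (fun x => rnorm (h x) `^ p)).
  apply/measurable_EFinP.
  apply: (measurableT_comp (measurable_powR p)).
  by apply: measurable_rnorm; exact: cLfun_measurable.
have isum (K : finType) (h : K -> cLfunType mu p1) :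
    (\sum_k \int[mu]_x (rnorm (h k x) `^ p)%:E =
     \int[mu]_x \sum_k (rnorm (h k x) `^ p)%:E)%E.
  rewrite ge0_integral_sum// => [k|k x _]; first exact: mg.
  by rewrite lee_fin powR_ge0.
rewrite -lee_fin EFinM -!sumEFin.
under eq_bigr do rewrite sE rnorm_pi_powR.
under [X in (_ <= _ * X)%E]eq_bigr do rewrite gE rnorm_pi_powR.
rewrite !isum.
rewrite -ge0_integralZl_EFin//; last 2 first.
- by move=> x _; rewrite sume_ge0// => j _; rewrite lee_fin powR_ge0.
- by apply: emeasurable_sum => j; exact: mg.
apply: ge0_le_integral => //.
- by move=> x _; rewrite sume_ge0// => j _; rewrite lee_fin powR_ge0.
- by apply: emeasurable_sum => j; exact: mg.
- by apply: emeasurable_funM => //; apply: emeasurable_sum => j; exact: mg.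
move=> x _; rewrite !sumEFin -EFinM lee_fin.
under eq_bigr do rewrite valE.
exact: scal.
Qed.

End Lp_extension.

(** * Gluing frequency windows on the D-th roots of unity *)

Section global_inequalities.
Context {R : realType} (J I : finType) (kap : J -> J -> R) (chi : I -> J -> J -> R[i]).
Hypothesis kap0 : forall t u, 0 <= kap t u.
Hypothesis kap_row : forall t, \sum_u kap t u = 1.
Hypothesis kap_col : forall u, \sum_t kap t u = 1.
Hypothesis chi1 : forall i t u, rnorm (chi i t u) = 1.
Hypothesis chi_orth : forall u i k,
  \sum_t ((kap t u)%:C)%C * (chi i t u * (chi k t u)^*%C) = (i == k)%:R.
Variables (V : normedModType R[i]) (p : R).
Hypothesis p1 : 1 < p.
Hypothesis V_ext : lp_extension V p.

(** By [V_ext] only scalars matter. For fixed [t] the row of [kap] is a probability, so Jensen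
    applies in [u]; for fixed [u] the column is a probability for which the [chi i] are orthonormal,
    so [local_synthesis] applies in [t]. *)
Lemma synthesis (f : I -> J -> V) :
  \sum_t rnorm (\sum_i \sum_u (((kap t u)%:C)%C * chi i t u) *: f i u) `^ p <=
  #|I|%:R `^ Num.max 0 (p - 2) * \sum_i \sum_u rnorm (f i u) `^ p.
Proof.
under eq_bigr do rewrite pair_big/=.
rewrite pair_big/=.
apply: (@V_ext _ _ (fun t iu => ((kap t iu.2)%:C)%C * chi iu.1 t iu.2) _ _ _
  (fun iu => f iu.1 iu.2)); first exact: powR_ge0.
move=> z.
have -> : \sum_j rnorm (z j) `^ p = \sum_u \sum_i rnorm (z (i, u)) `^ p.
  by rewrite exchange_big pair_big/=; apply: eq_bigr => -[].
rewrite mulr_sumr.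
apply: (@le_trans _ _ (\sum_t \sum_u kap t u * rnorm (\sum_i z (i, u) * chi i t u) `^ p)).
  apply: ler_sum => t _.
  apply: le_trans (powR_sum_jensen p1 (kap0 t) (kap_row t) _); last by move=> u; exact: rnorm_ge0.
  apply: (ge0_ler_powR (ltW (lt_trans ltr01 p1))); rewrite ?nnegrE ?rnorm_ge0//.
    by rewrite sumr_ge0// => u _; rewrite mulr_ge0 ?rnorm_ge0.
  have -> : \sum_j ((kap t j.2)%:C)%C * chi j.1 t j.2 * z j =
     \sum_u ((kap t u)%:C)%C * \sum_i z (i, u) * chi i t u.
    under [RHS]eq_bigr do rewrite mulr_sumr.
    rewrite exchange_big pair_big/=; apply: eq_bigr => -[i u] _ /=; ring.
  apply: le_trans (ler_rnorm_sum _ _ _) _; apply: ler_sum => u _.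
  by rewrite rnormM rnormR.
rewrite exchange_big; apply: ler_sum => u _ /=.
exact: (local_synthesis (kap0^~ u) (kap_col u) (fun i t => chi1 i t u) (chi_orth u)).
Qed.

(** The same two ingredients in the other order: [local_analysis] in [t] on each column, then the
    sum over [u] is absorbed by the mass 1 of the rows. *)
Lemma analysis (g : J -> V) :
  \sum_i \sum_u rnorm (\sum_t (((kap t u)%:C)%C * chi i t u) *: g t) `^ p <=
  #|I|%:R `^ Num.max 0 (2 - p) * \sum_t rnorm (g t) `^ p.
Proof.
rewrite pair_big/=.
apply: (@V_ext _ _ (fun iu t => ((kap t iu.2)%:C)%C * chi iu.1 t iu.2));
  first exact: powR_ge0.
move=> z.
have -> : \sum_i rnorm (\sum_j ((kap j i.2)%:C)%C * chi i.1 j i.2 * z j) `^ p =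
  \sum_u \sum_i rnorm (\sum_j ((kap j u)%:C)%C * (chi i j u * z j)) `^ p.
  rewrite exchange_big pair_big/=; apply: eq_bigr => -[i u] _ /=.
  by congr (rnorm _ `^ _); apply: eq_bigr => j _; rewrite mulrA.
apply: (@le_trans _ _ (#|I|%:R `^ Num.max 0 (2 - p) *
   \sum_u \sum_t kap t u * rnorm (z t) `^ p)).
  rewrite mulr_sumr; apply: ler_sum => u _.
  exact: (local_analysis (kap0^~ u) (kap_col u) (fun i t => chi1 i t u) (chi_orth u)).
rewrite ler_wpM2l ?powR_ge0// exchange_big/=; apply: ler_sum => t _.
by rewrite -mulr_suml kap_row mul1r.
Qed.

End global_inequalities.

(** * Roots of unity and their orthogonality *)

Lemma prim_root_exists (R : realType) (D : nat) : (0 < D)%N ->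
  exists z : R[i], D.-primitive_root z.
Proof.
move=> D0; pose q : {poly R[i]} := 'X^D - 1.
have [r Dq] := closed_field_poly_normal q.
have qm : lead_coef q = 1 by rewrite lead_coefDl ?lead_coefXn// size_polyXn size_polyN size_poly1.
rewrite qm scale1r in Dq.
have sr : (size r = D)%N.
  by apply: succn_inj; rewrite -(size_prod_XsubC r id) -Dq size_XnsubC.
have : has D.-primitive_root r.
  apply: cyclic.has_prim_root => //; first 2 last.
  - by rewrite sr.
  - by apply/allP => z; rewrite -root_prod_XsubC -Dq.
  rewrite -separable_prod_XsubC -Dq separable_Xn_sub_1// pnatr_eq0 -lt0n//.
by case/hasP => z _ zp; exists z.
Qed.

Lemma prim_root_rnorm (R : realType) (D : nat) (w : R[i]) : D.-primitive_root w ->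
  rnorm w = 1.
Proof.
move=> wp; have D0 := prim_order_gt0 wp.
apply/eqP; rewrite -(@pexpr_eq1 _ _ D) ?rnorm_ge0//.
by rewrite -rnormX (prim_expr_order wp) rnorm1.
Qed.

Lemma root_orthogonality (R : realType) (D : nat) (w : R[i]) (a b : nat) :
  D.-primitive_root w ->
  \sum_(t < D) (w ^+ t) ^+ a * ((w ^+ t) ^+ b)^-1 = (D%:R * (a == b %[mod D])%:R).
Proof.
move=> wp; have D0 := prim_order_gt0 wp.
have w0 : w != 0 by rewrite unimodular_neq0// (prim_root_rnorm wp).
under eq_bigr do rewrite -!exprM !(mulnC (nat_of_ord _)) !exprM -exprVn -exprMn.
rewrite -(eq_prim_root_expr wp).
have [e|ne] := eqVneq (w ^+ a) (w ^+ b).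
  rewrite e divff ?expf_neq0// mulr1.
  by under eq_bigr do rewrite expr1n; rewrite sumr_const card_ord.
rewrite mulr0; apply/eqP.
have q1 : w ^+ a / w ^+ b - 1 != 0.
  by rewrite subr_eq0; apply: contra_neq ne => /divr1_eq.
rewrite -(mulrI_eq0 _ (mulfI q1)) -subrX1 exprMn exprVn -!exprM.
by rewrite !(mulnC _ D) !exprM (prim_expr_order wp) !expr1n divr1 subrr.
Qed.

Lemma sum_ltn_ord (n l : nat) : (n <= l)%N -> (n <= \sum_(j < l) (j < n))%N.
Proof.
move=> nl; rewrite -(big_mkord xpredT (fun j => (j < n)%N : nat)) (big_cat_nat (leq0n n) nl)/=.
rewrite (eq_big_nat _ _ (F2 := fun=> 1%N)); last by move=> i /andP[_ ->].
by rewrite sum_nat_const_nat subn0 muln1 leq_addr.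
Qed.

(** * Fejer kernels and tents on the roots of unity *)

Section fejer.
Context {R : realType} (D l : nat) (w : R[i]).
Hypothesis wp : D.-primitive_root w.
Hypothesis l0 : (0 < l)%N.
Implicit Types (t u : 'I_D).

Definition twist t u : R[i] := w ^+ t * (w ^+ u)^-1.

(** The Fejer kernel of order [l], normalized to have total mass 1 in either variable as soon as l
    <= D. *)
Definition fejer t u : R := (l%:R * D%:R)^-1 * rnorm (\sum_(i < l) twist t u ^+ i) ^+ 2.

(** As long as [i + a] and [j + b] stay below [D], this is max(0, 1 - |a - b| / l), the triangular
    Fourier multiplier of the Fejer kernel. The count of pairs is what expanding the squared modulus
    in [fejer] produces. *)
Definition tent (a b : nat) : R :=
  l%:R^-1 * \sum_(i < l) \sum_(j < l) (i + a == j + b %[mod D])%:R.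

Lemma fejer_ge0 t u : 0 <= fejer t u.
Proof. by rewrite mulr_ge0 ?sqr_ge0// invr_ge0 mulr_ge0. Qed.

Lemma twist1 t u : rnorm (twist t u) = 1.
Proof. by rewrite rnormM rnormV !rnormX (prim_root_rnorm wp) !expr1n divr1. Qed.

Lemma fejerE t u (a b : nat) :
  ((fejer t u)%:C)%C * (twist t u ^+ a * (twist t u ^+ b)^-1) =
  (l%:R * D%:R)^-1 * \sum_(i < l) \sum_(j < l)
    (twist t u ^+ (i + a) * (twist t u ^+ (j + b))^-1).
Proof.
rewrite rmorphM/= fmorphV/= rmorphM/= !rmorph_nat -mulrA; congr (_ * _).
rewrite sqr_rnorm rmorph_sum/= -mulrA mulr_suml; apply: eq_bigr => i _.
rewrite mulrCA mulr_suml; apply: eq_bigr => j _.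
rewrite rmorphXn/= unimodular_conj ?twist1//.
by rewrite !exprD !exprVn !invfM; ring.
Qed.

Let w0 : w != 0. Proof. by rewrite unimodular_neq0// (prim_root_rnorm wp). Qed.

Let phase u (a b : nat) : a = b %[mod D] -> (w ^+ u) ^+ a = (w ^+ u) ^+ b.
Proof.
move=> ab; rewrite -!exprM !(mulnC u) !exprM; congr (_ ^+ u).
by apply/eqP; rewrite (eq_prim_root_expr wp); apply/eqP.
Qed.

Lemma twist_col u (a b : nat) :
  \sum_t twist t u ^+ a * (twist t u ^+ b)^-1 = D%:R * (a == b %[mod D])%:R.
Proof.
have -> : \sum_t twist t u ^+ a * (twist t u ^+ b)^-1 =
   ((w ^+ u) ^+ a)^-1 * (w ^+ u) ^+ b *
     \sum_(t < D) (w ^+ t) ^+ a * ((w ^+ t) ^+ b)^-1.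
  rewrite mulr_sumr; apply: eq_bigr => t _.
  by rewrite /twist !exprMn invfM !exprVn invrK; ring.
rewrite root_orthogonality//.
have [/phase ->|] := eqVneq; last by rewrite !mulr0.
by rewrite mulVf ?mul1r// !expf_neq0.
Qed.

Lemma twist_row t (a b : nat) :
  \sum_u twist t u ^+ a * (twist t u ^+ b)^-1 = D%:R * (a == b %[mod D])%:R.
Proof.
have -> : \sum_u twist t u ^+ a * (twist t u ^+ b)^-1 =
   (w ^+ t) ^+ a * ((w ^+ t) ^+ b)^-1 *
     \sum_(u < D) (w ^+ u) ^+ b * ((w ^+ u) ^+ a)^-1.
  rewrite mulr_sumr; apply: eq_bigr => u _.
  by rewrite /twist !exprMn invfM !exprVn invrK; ring.
rewrite root_orthogonality// [in LHS]eq_sym.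
have [/phase ->|] := eqVneq; last by rewrite !mulr0.
by rewrite divff ?mul1r// !expf_neq0.
Qed.

Let D0 : (0 < D)%N. Proof. exact: prim_order_gt0 wp. Qed.

(** With a = b = 0 this computes the mass of a column; with [a] and [b] two window centres it is the
    inner product of two modulations. *)
Lemma fejer_col u (a b : nat) :
  \sum_t ((fejer t u)%:C)%C * (twist t u ^+ a * (twist t u ^+ b)^-1) = ((tent a b)%:C)%C.
Proof.
under eq_bigr do rewrite fejerE.
rewrite -mulr_sumr exchange_big/=.
under eq_bigr do rewrite exchange_big/=.
rewrite /tent rmorphM/= fmorphV rmorph_nat rmorph_sum/=.
under [in RHS]eq_bigr do rewrite rmorph_sum/=.
rewrite invfM -mulrA; congr (_ * _); rewrite mulr_sumr; apply: eq_bigr => i _.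
rewrite mulr_sumr; apply: eq_bigr => j _.
by rewrite twist_col mulKf ?rmorph_nat // pnatr_eq0 -lt0n.
Qed.

Lemma fejer_row t (a b : nat) :
  \sum_u ((fejer t u)%:C)%C * (twist t u ^+ a * (twist t u ^+ b)^-1) = ((tent a b)%:C)%C.
Proof.
under eq_bigr do rewrite fejerE.
rewrite -mulr_sumr exchange_big/=.
under eq_bigr do rewrite exchange_big/=.
rewrite /tent rmorphM/= fmorphV rmorph_nat rmorph_sum/=.
under [in RHS]eq_bigr do rewrite rmorph_sum/=.
rewrite invfM -mulrA; congr (_ * _); rewrite mulr_sumr; apply: eq_bigr => i _.
rewrite mulr_sumr; apply: eq_bigr => j _.
by rewrite twist_row mulKf ?rmorph_nat // pnatr_eq0 -lt0n.
Qed.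

(** The convolution theorem: the kernel modulated at frequency [a] acts on the mode [m] by the value
    at [m] of the tent centred at [a]. *)
Lemma fejer_mode t (a m : nat) :
  \sum_u (((fejer t u)%:C)%C * twist t u ^+ a) * (w ^+ u) ^+ m =
  ((tent a m)%:C)%C * (w ^+ t) ^+ m.
Proof.
rewrite -(fejer_row t) mulr_suml; apply: eq_bigr => u _.
rewrite -!mulrA; do 2 congr (_ * _).
by rewrite /twist exprMn exprVn invfM invrK mulrAC mulVf ?mul1r// !expf_neq0.
Qed.

Lemma tent_ge0 a b : 0 <= tent a b.
Proof.
by rewrite mulr_ge0 ?invr_ge0// sumr_ge0// => i _; rewrite sumr_ge0.
Qed.

(** The size conditions exclude wrapping modulo [D], and i + l a = j + l b forces i = j and a = b by
    uniqueness of Euclidean division by [l]. The [l] diagonal pairs cancel the factor 1/l. *)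
Lemma tent_orth (a b : nat) : (l * a.+1 <= D)%N -> (l * b.+1 <= D)%N ->
  tent (l * a) (l * b) = (a == b)%:R.
Proof.
move=> aD bD; rewrite /tent.
have lt (i : 'I_l) c : (l * c.+1 <= D)%N -> (i + l * c < D)%N.
  by move=> cD; apply: leq_trans cD; rewrite mulnS ltn_add2r.
have e (i j : 'I_l) : (i + l * a == j + l * b %[mod D]) = (j == i) && (a == b).
  rewrite !modn_small ?lt//.
  apply/eqP/andP => [h|[/eqP-> /eqP->//]].
  rewrite ![(_ + l * _)%N]addnC !(mulnC l) in h.
  have := congr1 (modn^~ l) h; rewrite !modnMDl !modn_small// => ij.
  have := congr1 (divn^~ l) h; rewrite !divnMDl// !divn_small// !addn0 => ab.
  by split; apply/eqP => //; apply: val_inj.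
under eq_bigr => i _ do under eq_bigr => j _ do rewrite e.
have [_|_] := eqVneq a b; last first.
  rewrite big1 ?mulr0// => i _; rewrite big1// => j _; by rewrite andbF.
under eq_bigr => i _.
  rewrite (bigD1 i)//= eqxx big1 ?addr0; last by move=> j /negbTE->.
  over.
by rewrite sumr_const card_ord mulVf// pnatr_eq0 gtn_eqF.
Qed.

(** A shift by at most l/2 still pairs at least half of the [l] indices. *)
Lemma tent_ge_half (a m : nat) : (m <= a + l./2)%N -> (a <= m + l./2)%N ->
  2^-1 <= tent a m.
Proof.
move=> ma am.
have half : (l <= (l - l./2).*2)%N by lia.
have key : (l - l./2)%:R <= \sum_(i < l) \sum_(j < l) (i + a == j + m %[mod D])%:R :> R.
  have [le|/ltnW le] := leqP a m.
    rewrite exchange_big/=.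
    apply: (@le_trans _ _ (\sum_(j < l) (j + (m - a) < l)%N%:R)).
      rewrite -natr_sum ler_nat.
      under eq_bigr do rewrite addnC -ltn_subRL.
      by apply: leq_trans (sum_ltn_ord _); rewrite ?leq_subr//; lia.
    apply: ler_sum => j _.
    have [h|//] := ltnP; last by rewrite sumr_ge0.
    rewrite (bigD1 (Ordinal h))//= -addnA subnK// eqxx lerDl sumr_ge0//.
  apply: (@le_trans _ _ (\sum_(i < l) (i + (a - m) < l)%N%:R)).
    rewrite -natr_sum ler_nat.
    under eq_bigr do rewrite addnC -ltn_subRL.
    by apply: leq_trans (sum_ltn_ord _); rewrite ?leq_subr//; lia.
  apply: ler_sum => i _.
  have [h|//] := ltnP; last by rewrite sumr_ge0.
  rewrite (bigD1 (Ordinal h))//= -addnA subnK// eqxx lerDl sumr_ge0//.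
rewrite /tent mulrC ler_pdivlMr ?ltr0n//.
apply: le_trans key.
rewrite mulrC ler_pdivrMr// -natrM ler_nat; lia.
Qed.

End fejer.

(** * Polynomials in T *)

Section operator_calculus.
Context {R : realType} {V : normedModType R[i]} (T : V -> V).
Hypothesis Tlin : linear T.

Definition act (h : {poly R[i]}) (x : V) : V := \sum_(i < size h) h`_i *: iter i T x.

Lemma actE n (h : {poly R[i]}) x : (size h <= n)%N ->
  act h x = \sum_(i < n) h`_i *: iter i T x.
Proof.
move=> hn; rewrite /act (big_ord_widen _ (fun i => h`_i *: iter i T x) hn).
rewrite big_mkcond; apply: eq_bigr => i _.
by case: ltnP => // hi; rewrite nth_default ?scale0r.
Qed.

Lemma linearTD x y : T (x + y) = T x + T y.
Proof. by have := Tlin 1 x y; rewrite !scale1r. Qed.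

Lemma linearT0 : T 0 = 0.
Proof. by apply: (addrI (T 0)); rewrite -linearTD !addr0. Qed.

Lemma linearTZ a x : T (a *: x) = a *: T x.
Proof. by have := Tlin a x 0; rewrite linearT0 !addr0. Qed.

Lemma linear_iter n : linear (iter n T).
Proof. by elim: n => [//|n IH] a x y; rewrite !iterS IH Tlin. Qed.

Lemma act0 x : act 0 x = 0.
Proof. by rewrite (@actE 0) ?size_poly0// big_ord0. Qed.

Lemma actD g h x : act (g + h) x = act g x + act h x.
Proof.
rewrite !(@actE (maxn (size g) (size h))) ?leq_maxl ?leq_maxr ?size_polyD//.
by rewrite -big_split; apply: eq_bigr => i _; rewrite coefD scalerDl.
Qed.

Lemma actZ a h x : act (a *: h) x = a *: act h x.
Proof.
rewrite !(@actE (size h)) ?size_scale_leq// scaler_sumr.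
by apply: eq_bigr => i _; rewrite coefZ scalerA.
Qed.

Lemma actC a x : act a%:P x = a *: x.
Proof. by rewrite (@actE 1) ?size_polyC_leq1// big_ord1 coefC. Qed.

Lemma act1 x : act 1 x = x.
Proof. by rewrite actC scale1r. Qed.

Lemma actMX h x : act (h * 'X) x = act h (T x).
Proof.
rewrite (@actE (size h).+1); last first.
  have [->|h0] := eqVneq h 0; first by rewrite mul0r size_poly0.
  by rewrite size_mulX.
rewrite big_ord_recl coefMX scale0r add0r; apply: eq_bigr => i _.
by rewrite coefMX/= -iterS iterSr.
Qed.

Lemma act_linear h : linear (act h).
Proof.
move=> a x y; rewrite /act scaler_sumr -big_split; apply: eq_bigr => i _ /=.
by rewrite linear_iter scalerDr !scalerA mulrC.
Qed.

Lemma actT h x : act h (T x) = T (act h x).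
Proof.
rewrite /act (big_morph T linearTD linearT0); apply: eq_bigr => i _.
by rewrite linearTZ -iterSr.
Qed.

Lemma actM g h x : act (g * h) x = act g (act h x).
Proof.
elim/poly_ind: g x => [|g c IH] x; first by rewrite mul0r !act0.
rewrite mulrDl -mulrA ['X * _]mulrC mulrA !actD !actMX IH actT.
by rewrite mul_polyC actZ actC.
Qed.

Lemma act_sumr h (I : Type) (r : seq I) (P : pred I) (F : I -> V) :
  act h (\sum_(i <- r | P i) F i) = \sum_(i <- r | P i) act h (F i).
Proof.
have a0 : act h 0 = 0.
  by rewrite -{1}(subrr (0 : V)) -scaleN1r addrC act_linear scaleN1r addNr.
have aD x y : act h (x + y) = act h x + act h y.
  by have := act_linear h 1 x y; rewrite !scale1r.
exact: (big_morph _ aD a0).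
Qed.

Lemma act_scaler h a x : act h (a *: x) = a *: act h x.
Proof.
have a0 : act h 0 = 0.
  by rewrite -{1}(subrr (0 : V)) -scaleN1r addrC act_linear scaleN1r addNr.
by have := act_linear h a x 0; rewrite a0 !addr0.
Qed.

(** The polynomial b(zX), so that [op b z] is b(zT). The coefficients of [b] are kept real because
    lower bounds on products rely on their signs. *)
Definition dil (z : R[i]) (b : {poly R}) : {poly R[i]} :=
  map_poly (real_complex R) b \Po (z *: 'X).

Lemma dilM z b c : dil z (b * c) = dil z b * dil z c.
Proof. by rewrite /dil rmorphM comp_polyM. Qed.

Lemma dilD z b c : dil z (b + c) = dil z b + dil z c.
Proof. by rewrite /dil rmorphD comp_polyD. Qed.

Lemma coef_dil z b i : (dil z b)`_i = ((b`_i)%:C)%C * z ^+ i.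
Proof.
rewrite /dil comp_polyE coef_sum.
under eq_bigr do rewrite exprZn coefZ coefZ coefXn.
have [ib|bi] := ltnP i (size (map_poly (real_complex R) b)).
  rewrite (bigD1 (Ordinal ib))//= eqxx mulr1 big1 ?addr0 ?coef_map//.
  by move=> j ji; rewrite [i == j]eq_sym (negbTE (ji : val j != i)) !mulr0.
rewrite big1; last by move=> j _; rewrite gtn_eqF ?mulr0// (leq_trans _ bi).
by rewrite -(coef_map (real_complex R)) nth_default// mul0r.
Qed.

Lemma size_dil z b : (size (dil z b) <= size b)%N.
Proof.
by apply/leq_sizeP => j bj; rewrite coef_dil nth_default// mul0r.
Qed.

Definition op (b : {poly R}) (z : R[i]) (x : V) : V := act (dil z b) x.

Lemma opE n (b : {poly R}) z x : (size b <= n)%N ->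
  op b z x = \sum_(i < n) (((b`_i)%:C)%C * z ^+ i) *: iter i T x.
Proof.
move=> bn; rewrite /op (actE _ (leq_trans (size_dil z b) bn)).
by apply: eq_bigr => i _; rewrite coef_dil.
Qed.

Lemma opM b c z x : op (b * c) z x = op b z (op c z x).
Proof. by rewrite /op dilM actM. Qed.

Lemma opZ a b z x : op (a *: b) z x = ((a%:C)%C) *: op b z x.
Proof.
rewrite !(@opE (size b)) ?size_scale_leq// scaler_sumr.
by apply: eq_bigr => i _; rewrite coefZ rmorphM/= scalerA mulrA.
Qed.

Lemma op1 z x : op 1 z x = x.
Proof. by rewrite /op /dil rmorph1 comp_polyC act1. Qed.

Lemma opD b c z x : op (b + c) z x = op b z x + op c z x.
Proof. by rewrite /op dilD actD. Qed.

Lemma op_sum (I : Type) (r : seq I) (P : pred I) (F : I -> {poly R}) z x :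
  op (\sum_(i <- r | P i) F i) z x = \sum_(i <- r | P i) op (F i) z x.
Proof.
elim/big_rec2 : _ => [|i y1 y2 _ <-]; last by rewrite opD.
by rewrite /op /dil rmorph0 comp_poly0 act0.
Qed.

(** Discrete Fourier inversion; no aliasing occurs since the degree of [h] and [M] are both below
    [D]. *)
Lemma extraction (D : nat) (w : R[i]) (h : {poly R}) (M : nat) x :
  D.-primitive_root w -> (size h <= D)%N -> (M < D)%N ->
  \sum_(t < D) ((w ^+ t) ^+ M)^-1 *: op h (w ^+ t) x =
  (D%:R * ((h`_M)%:C)%C) *: iter M T x.
Proof.
move=> wp hD MD.
under eq_bigr do rewrite (opE _ _ hD) scaler_sumr.
rewrite exchange_big/=.
under eq_bigr => i _.
  under eq_bigr do rewrite scalerA mulrCA (mulrC _^-1).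
  rewrite -scaler_suml -mulr_sumr root_orthogonality// (modn_small MD) modn_small//.
  over.
rewrite (bigD1 (Ordinal MD))//= eqxx mulr1 mulrC big1 ?addr0// => i iM.
by rewrite (negbTE (iM : val i != M)) !mulr0 scale0r.
Qed.

End operator_calculus.

(** * Truncated negative binomial weights *)

Section geometric_weights.
Context {R : realType}.
Implicit Types (a Q k g : nat) (G H : {poly R}) (c d : R).

(** The expansion of a / (a + 1 - X) cut at degree [Q]: a truncated geometric law of mean 1/a, whose
    powers are truncated negative binomial laws. *)
Definition geo a Q : {poly R} := \sum_(n < Q) (a%:R / a.+1%:R ^+ n.+1) *: 'X^n.

Lemma coef_geo a Q i :
  (geo a Q)`_i = if (i < Q)%N then a%:R / a.+1%:R ^+ i.+1 else 0.
Proof.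
rewrite /geo coef_sum; under eq_bigr do rewrite coefZ coefXn.
case: ltnP => [iQ|Qi].
  rewrite (bigD1 (Ordinal iQ))//= eqxx mulr1 big1 ?addr0// => j ji.
  by rewrite [i == j]eq_sym (negbTE (ji : val j != i)) mulr0.
by rewrite big1// => j _; rewrite gtn_eqF ?mulr0// (leq_trans _ Qi).
Qed.

(** A telescoping product: at zT, [geo a Q] is a multiple of the resolvent up to the small term (zT
    / (a + 1))^Q. *)
Lemma geo_resolvent a Q :
  geo a Q * (a.+1%:R%:P - 'X) = a%:R *: (1 - (a.+1%:R ^- Q) *: 'X^Q).
Proof.
elim: Q => [|Q IH].
  by rewrite /geo big_ord0 mul0r !expr0 invr1 scale1r subrr scaler0.
rewrite /geo big_ord_recr/= mulrDl -/(geo a Q) IH.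
have a0 : a.+1%:R != 0 :> R by rewrite pnatr_eq0.
have e : (a.+1%:R ^- Q.+1)%:P * a.+1%:R%:P = (a.+1%:R ^- Q)%:P :> {poly R}.
  by rewrite -polyCM exprS invfM mulrAC mulVf// mul1r.
rewrite -!mul_polyC polyCM -e (exprS 'X).
set b := _%:P; set c := _%:P; set u := _%:P; ring.
Qed.

Section moments.
Variable a : nat.

(* [euler c] multiplies the coefficient of X^i by a i - c; being a derivation
   up to the shift of c, it computes the centered moments of products. *)
Definition euler c G : {poly R} := a%:R *: ('X * G^`()) - c *: G.

Lemma coef_euler c G i : (euler c G)`_i = (a%:R * i%:R - c) * G`_i.
Proof.
rewrite coefB !coefZ coefXM coef_deriv mulrBl; case: i => [|i] /=.
  by rewrite !mulr0 mul0r.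
by rewrite -[G`_i.+1 *+ _]mulr_natl mulrA.
Qed.

Lemma eulerM c d G H : euler (c + d) (G * H) = euler c G * H + G * euler d H.
Proof. by rewrite /euler derivM -!mul_polyC polyCD; ring. Qed.

Lemma euler_moment c G n : (size G <= n)%N ->
  (euler c G).[1] = \sum_(i < n) (a%:R * i%:R - c) * G`_i.
Proof.
move=> Gn; rewrite (@horner_coef_wide _ n).
  by apply: eq_bigr => i _; rewrite coef_euler expr1n mulr1.
by apply/leq_sizeP => j nj; rewrite coef_euler [G`_j]nth_default ?mulr0// (leq_trans Gn).
Qed.

Lemma size_euler c G : (size (euler c G) <= size G)%N.
Proof. by apply/leq_sizeP => j nj; rewrite coef_euler [G`_j]nth_default ?mulr0. Qed.

Lemma euler_moment2 c G n : (size G <= n)%N ->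
  (euler c (euler c G)).[1] = \sum_(i < n) (a%:R * i%:R - c) ^+ 2 * G`_i.
Proof.
move=> Gn; rewrite (@euler_moment _ _ n) ?(leq_trans (size_euler _ _))//.
by apply: eq_bigr => i _; rewrite coef_euler mulrA.
Qed.

Lemma euler1M c d G H : (euler (c + d) (G * H)).[1] =
  (euler c G).[1] * H.[1] + G.[1] * (euler d H).[1].
Proof. by rewrite eulerM; move: (euler c G) (euler d H) => A B; rewrite hornerD !hornerM. Qed.

Lemma euler2M c d G H : (euler (c + d) (euler (c + d) (G * H))).[1] =
  (euler c (euler c G)).[1] * H.[1] + 2 * ((euler c G).[1] * (euler d H).[1]) +
  G.[1] * (euler d (euler d H)).[1].
Proof.
have eD c' G' H' : euler c' (G' + H') = euler c' G' + euler c' H'.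
  by rewrite /euler derivD -!mul_polyC; ring.
rewrite eulerM eD !eulerM.
move: (euler c G) (euler c (euler c G)) (euler d H) (euler d (euler d H)) => A B C E.
by rewrite !hornerD !hornerM; ring.
Qed.

Variable Q : nat.
(** The mass of the geometric law beyond the truncation; all truncation errors below are multiples
    of it. *)
Let z : R := a.+1%:R ^- Q.

Let size_geo : (size (geo a Q) <= Q)%N.
Proof. by apply/leq_sizeP => j Qj; rewrite coef_geo ltnNge Qj. Qed.

Let an0 : a.+1%:R != 0 :> R. Proof. by rewrite pnatr_eq0. Qed.

Lemma geo_mass : (geo a Q).[1] = 1 - z.
Proof.
rewrite (horner_coef_wide _ size_geo).
under eq_bigr => i _ do rewrite coef_geo ltn_ord expr1n mulr1.
rewrite /z; elim: Q => [|n IH]; first by rewrite big_ord0 expr0 invr1 subrr.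
rewrite big_ord_recr/= IH exprS invfM.
rewrite (_ : a%:R = a.+1%:R - 1 :> R); last by rewrite -natr1; ring.
have := expf_neq0 n an0; move: (a.+1%:R : R) an0 => A A0 An0.
by field; rewrite An0 A0.
Qed.

Lemma geo_moment1 : (euler 1 (geo a Q)).[1] = - (a%:R * Q%:R * z).
Proof.
rewrite (euler_moment _ size_geo).
under eq_bigr => i _ do rewrite coef_geo ltn_ord.
rewrite /z; elim: Q => [|n IH]; first by rewrite big_ord0 mulr0 mul0r oppr0.
rewrite big_ord_recr/= IH exprS invfM -[n.+1%:R]natr1.
rewrite (_ : a%:R = a.+1%:R - 1 :> R); last by rewrite -natr1; ring.
have := expf_neq0 n an0; move: (a.+1%:R : R) an0 => A A0 An0.
by field; rewrite An0 A0.
Qed.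

Lemma geo_moment2 : (euler 1 (euler 1 (geo a Q))).[1] =
  a.+1%:R - (a%:R ^+ 2 * Q%:R ^+ 2 + a.+1%:R) * z.
Proof.
rewrite (euler_moment2 _ size_geo).
under eq_bigr => i _ do rewrite coef_geo ltn_ord.
rewrite /z; elim: Q => [|n IH].
  by rewrite big_ord0 expr0 invr1 expr0n/= mulr0 add0r mulr1 subrr.
rewrite big_ord_recr/= IH (exprS a.+1%:R n) invfM -[n.+1%:R]natr1.
rewrite (_ : a%:R = a.+1%:R - 1 :> R); last by rewrite -natr1; ring.
have := expf_neq0 n an0; move: (a.+1%:R : R) an0 => A A0 An0.
by field; rewrite An0 A0.
Qed.

Let z0 : 0 < z. Proof. by rewrite invr_gt0 exprn_gt0. Qed.
Let z1 : z <= 1.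
Proof. by rewrite invf_le1 ?exprn_gt0// exprn_ege1// ler1n. Qed.

(** Induction on the number of factors: by [euler2M] the centered second moments add up. The cross
    term is at most 2 k M^2, which with k^2 M^2 stays below (k + 1)^2 M^2. *)
Lemma geo_power_moments k : let M := a%:R * Q%:R * z in
  [/\ 1 - k%:R * z <= (geo a Q ^+ k).[1] <= 1,
      - (k%:R * M) <= (euler k%:R (geo a Q ^+ k)).[1] <= 0 &
      (euler k%:R (euler k%:R (geo a Q ^+ k))).[1] <=
        k%:R * a.+1%:R + k%:R ^+ 2 * M ^+ 2].
Proof.
move=> M; have M0 : 0 <= M by rewrite !mulr_ge0// ltW.
have an : 0 < a.+1%:R :> R by rewrite ltr0n.
elim: k => [|k [/andP[IHa IHb] /andP[IHc IHd] IHe]].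
  rewrite expr0 hornerC mul0r subr0 lexx/=.
  have e0 c G : euler 0 (1 : {poly R}) = 0 by rewrite /euler derivC mulr0 scaler0 scale0r subrr.
  rewrite !(e0 0 0) /euler derivC mulr0 scaler0 scale0r subrr horner0 !mul0r oppr0 lexx.
  by rewrite expr0n/= mul0r addr0.
rewrite exprSr -natr1 euler2M euler1M hornerM geo_mass geo_moment1 geo_moment2 -/M.
set p0 := _.[1] in IHa IHb *; set p1 := _.[1] in IHc IHd *.
set p2 := _.[1] in IHe *.
have k0 : 0 <= k%:R :> R by [].
have z1' : 0 <= 1 - z by rewrite subr_ge0.
have m2 : 0 <= (a%:R ^+ 2 * Q%:R ^+ 2 + a.+1%:R) * z.
  by rewrite mulr_ge0 ?addr_ge0 ?mulr_ge0 ?sqr_ge0// ltW.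
have p00 : 0 <= p0.
  rewrite /p0 horner_exp geo_mass exprn_ge0//.
split.
- apply/andP; split; first nra.
  by rewrite -[leRHS]mulr1 ler_pM// gerBl ltW.
- apply/andP; split; nra.
- have B0 : 0 <= k%:R * a.+1%:R + k%:R ^+ 2 * M ^+ 2.
    exact: addr_ge0 (mulr_ge0 k0 (ltW an)) (mulr_ge0 (sqr_ge0 _) (sqr_ge0 _)).
  have h1 : p2 * (1 - z) <= k%:R * a.+1%:R + k%:R ^+ 2 * M ^+ 2.
    apply: le_trans (ler_wpM2r z1' IHe) _.
    by rewrite -[leRHS]mulr1 ler_wpM2l// gerBl ltW.
  have h2 : p1 * - M <= k%:R * M ^+ 2 by nra.
  have h3 : p0 * (a.+1%:R - (a%:R ^+ 2 * Q%:R ^+ 2 + a.+1%:R) * z) <= a.+1%:R.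
    apply: (@le_trans _ _ (p0 * a.+1%:R)); first by rewrite ler_wpM2l// gerBl.
    by rewrite -[leRHS]mul1r ler_wpM2r// ltW.
  have MM : 0 <= M ^+ 2 by exact: sqr_ge0.
  by lra.
Qed.

End moments.

Lemma geo_ge0 a Q k i : 0 <= (geo a Q ^+ k)`_i.
Proof.
elim: k i => [|k IH] i; first by rewrite expr0 coefC; case: ifP.
rewrite exprS coefM sumr_ge0// => j _; rewrite mulr_ge0// coef_geo.
by case: ifP => // _; rewrite divr_ge0// exprn_ge0.
Qed.

(** Chebyshev's inequality. With k = a g, the quantity a i - k is a (i - g), so the second moment,
    at most 3 a^2 g, leaves mass at most 3 g / r^2 <= 1/4 outside of the window. The condition on
    [Q] keeps the total mass above 3/4. *)
Lemma geo_concentration a Q g (r : nat) : (0 < a)%N -> (0 < g)%N ->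
  4 * (a * g)%:R * Q.+1%:R <= a.+1%:R ^+ Q :> R -> (12 * g <= r ^ 2)%N ->
  2^-1 <= \sum_(i < size (geo a Q ^+ (a * g)) | (i <= g + r)%N && (g <= i + r)%N)
     (geo a Q ^+ (a * g))`_i.
Proof.
move=> a0 g0 hQ hr; set k := (a * g)%N in hQ *.
set z : R := a.+1%:R ^- Q.
have [/andP[m0 _] _ m2] := geo_power_moments a Q k.
rewrite -/z in m0 m2.
have p0 : 0 < a.+1%:R ^+ Q :> R by rewrite exprn_gt0.
have zQ : 4 * k%:R * Q.+1%:R * z <= 1 by rewrite ler_pdivrMr// mul1r.
have z0 : 0 < z by rewrite invr_gt0.
set G := geo a Q ^+ k in m0 m2 *.
have G0 i : 0 <= G`_i by exact: geo_ge0.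
have kE : k%:R = a%:R * g%:R :> R by rewrite natrM.
have kz : k%:R * z <= 4^-1.
  have : k%:R * z <= k%:R * Q.+1%:R * z.
    by rewrite ler_wpM2r ?(ltW z0)// ler_peMr// ler1n.
  by lra.
have kQz : k%:R * Q%:R * z <= 1.
  have : 0 <= k%:R * Q%:R * z by rewrite !mulr_ge0// ltW.
  have : 0 <= k%:R * z by rewrite !mulr_ge0// ltW.
  by rewrite -natr1 in zQ; lra.
have a1 : 1 <= a%:R :> R by rewrite ler1n.
have g1 : 1 <= g%:R :> R by rewrite ler1n.
have var : (euler a k%:R (euler a k%:R G)).[1] <= 3 * a%:R ^+ 2 * g%:R.
  apply: le_trans m2 _.
  have -> : k%:R ^+ 2 * (a%:R * Q%:R * z) ^+ 2 = a%:R ^+ 2 * (k%:R * Q%:R * z) ^+ 2 by ring.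
  have : (k%:R * Q%:R * z) ^+ 2 <= 1.
    by rewrite expr_le1// !mulr_ge0// ltW.
  have : k%:R * a.+1%:R <= 2 * a%:R ^+ 2 * g%:R :> R.
    rewrite kE -natr1 [leRHS](_ : _ = a%:R * g%:R * (2 * a%:R)); last by ring.
    by rewrite ler_wpM2l ?mulr_ge0//; lra.
  move=> h1 h2.
  have h3 : a%:R ^+ 2 * (k%:R * Q%:R * z) ^+ 2 <= a%:R ^+ 2 * g%:R.
    by rewrite ler_wpM2l ?sqr_ge0//; lra.
  by lra.
rewrite (euler_moment2 _ _ (leqnn (size G))) in var.
rewrite horner_coef in m0.
have sE : \sum_(i < size G) G`_i * 1 ^+ i = \sum_(i < size G) G`_i.
  by apply: eq_bigr => i _; rewrite expr1n mulr1.
rewrite sE in m0.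
rewrite (bigID (fun i : 'I_(size G) => (i <= g + r)%N && (g <= i + r)%N))/= in m0.
set A := \sum_(i < _ | _) _ in m0 *; set B := \sum_(i < _ | _) _ in m0.
suff B4 : B <= 4^-1 by lra.
have far : a%:R ^+ 2 * r%:R ^+ 2 * B <= 3 * a%:R ^+ 2 * g%:R.
  apply: le_trans var; rewrite /B mulr_sumr big_mkcond/=.
  apply: ler_sum => i _; case: ifPn => [h|_]; last by rewrite mulr_ge0 ?sqr_ge0.
  rewrite ler_wpM2r//.
  have -> : (a%:R * i%:R - k%:R) ^+ 2 = a%:R ^+ 2 * (i%:R - g%:R) ^+ 2 :> R.
    by rewrite kE; ring.
  rewrite ler_wpM2l ?sqr_ge0//.
  have : (g + r <= i)%N || (i + r <= g)%N by lia.
  have r0 : 0 <= r%:R :> R by [].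
  case/orP; rewrite -(ler_nat R) natrD => {}h.
    by rewrite ler_pXn2r ?nnegrE//; lra.
  by rewrite -[leRHS]sqrrN ler_pXn2r ?nnegrE//; lra.
have hr' : 12 * g%:R <= r%:R ^+ 2 :> R by rewrite -natrX -natrM ler_nat.
have B0 : 0 <= B by rewrite sumr_ge0.
have : a%:R ^+ 2 * (12 * g%:R * B) <= a%:R ^+ 2 * (3 * g%:R).
  apply: le_trans (_ : _ <= a%:R ^+ 2 * r%:R ^+ 2 * B) _.
    by rewrite -[leRHS]mulrA ler_wpM2l ?sqr_ge0// ler_wpM2r.
  by apply: le_trans far _; apply: ler_eq; ring.
rewrite ler_pM2l; last by rewrite exprn_gt0//; lra.
have g12 : 0 < 12 * g%:R :> R by lra.
by move=> gB; rewrite -(ler_pM2l g12); lra.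
Qed.

(** The coefficient is k (a / (a + 1))^(k-1) a / (a + 1)^2. Bernoulli's inequality bounds the middle
    power below by 1/2, and a + 1 = 2 k gives (2 k - 1) / (8 k) >= 1/8. *)
Lemma geo_coef1 a Q k : (1 < Q)%N -> (a.+1 = 2 * k)%N ->
  8^-1 <= (geo a Q ^+ k)`_1.
Proof.
move=> Q1 ak.
have g0 : (geo a Q)`_0 = a%:R / a.+1%:R by rewrite coef_geo (ltnW Q1).
have g1 : (geo a Q)`_1 = a%:R / a.+1%:R ^+ 2 by rewrite coef_geo Q1.
have e0 n : (geo a Q ^+ n)`_0 = (a%:R / a.+1%:R) ^+ n.
  elim: n => [|n IH]; first by rewrite !expr0 coefC.
  by rewrite !exprS coefM big_ord1 IH g0.
have e1 n : (geo a Q ^+ n.+1)`_1 = n.+1%:R * (a%:R / a.+1%:R) ^+ n * (a%:R / a.+1%:R ^+ 2).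
  elim: n => [|n IH]; first by rewrite expr1 expr0 g1; ring.
  rewrite exprS coefM big_ord_recr big_ord1/= IH g1 g0 e0 -[n.+2%:R]natr1.
  by rewrite (exprS (a%:R / a.+1%:R) n); set x := _ / _; set y := _ / _; ring.
case: k ak => // k ak.
have aE : a%:R = 2 * k%:R + 1 :> R by rewrite -natrM natr1; congr _%:R; lia.
have a1E : a.+1%:R = 2 * k%:R + 2 :> R by rewrite -natr1 aE; ring.
have k0 : 0 <= k%:R :> R by [].
have bern n : 1 - n%:R / a.+1%:R <= (a%:R / a.+1%:R) ^+ n :> R.
  elim: n => [|n IH]; first by rewrite mul0r subr0 expr0.
  rewrite exprS -natr1.
  have -> : a%:R / a.+1%:R = 1 - a.+1%:R^-1 :> R by rewrite aE a1E; field; lra.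
  have : a.+1%:R^-1 <= 1 :> R by rewrite invf_le1 ?ler1n.
  have : 0 <= a.+1%:R^-1 :> R by rewrite invr_ge0.
  have : 0 <= n%:R :> R by [].
  move: IH; rewrite (_ : a%:R / a.+1%:R = 1 - a.+1%:R^-1 :> R).
    by set y := _^-1; set t := _ ^+ n; nra.
  by rewrite aE a1E; field; lra.
have half : 2^-1 <= (a%:R / a.+1%:R) ^+ k :> R.
  apply: le_trans (bern k); rewrite a1E lerBrDl -lerBrDr ler_pdivrMr; lra.
rewrite e1 -[k.+1%:R]natr1.
apply: (@le_trans _ _ ((k%:R + 1) * 2^-1 * (a%:R / a.+1%:R ^+ 2))).
  rewrite aE a1E (_ : (_ + _) * _ * _ = (2 * k%:R + 1) / (8 * (k%:R + 1))); last by field; lra.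
  by rewrite ler_pdivlMr; lra.
rewrite ler_wpM2r ?divr_ge0 ?exprn_ge0// ler_wpM2l//; lra.
Qed.

End geometric_weights.

(** * Norm estimates for the weights from the resolvent bounds *)

Section weights.
Context {R : realType} {V : normedModType R[i]} (T : V -> V).
Hypothesis Tlin : linear T.

(** The resolvent enters as a right inverse of l - T with bounds on each vector, so that no supremum
    has to be handled. *)
Definition kreiss_resolvents (L : R) : Prop :=
  forall l : R[i], 1 < rnorm l -> exists S : V -> V,
    (forall x, l *: S x - T (S x) = x) /\
    forall k x, (0 < k)%N ->
      rnorm (iter k S x) <= L / (rnorm l - 1) ^+ k * rnorm x.

(** Cauchy's estimate for the coefficient of T^M, by averaging over roots of unity of an order
    exceeding [M] and the degree of [h]. *)
Lemma op_coef_bound (h : {poly R}) (B : R) (x : V) (M : nat) : 0 <= h`_M ->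
  (forall z, rnorm z = 1 -> rnorm (op T h z x) <= B) ->
  h`_M * rnorm (iter M T x) <= B.
Proof.
move=> hM hB; pose D := (size h + M).+1.
have [w wp] := @prim_root_exists R D isT.
have D0 : 0 < D%:R :> R by rewrite ltr0n.
have := extraction T x wp (_ : size h <= D)%N (_ : M < D)%N.
move=> /(_ ltac:(by rewrite /D; lia) ltac:(by rewrite /D; lia)) E.
have := congr1 (@rnorm R V) E; rewrite rnormZ rnormM (rnormR hM).
have -> : rnorm (D%:R : R[i]) = D%:R.
  by rewrite -(rmorph_nat (real_complex R)) rnormR// ltW.
move=> {}E; rewrite -(ler_pM2l D0) mulrA -E.
apply: le_trans (ler_rnorm_sum _ _ _) _.
have -> : D%:R * B = \sum_(t < D) B by rewrite sumr_const card_ord mulr_natl.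
have w1 := prim_root_rnorm wp.
apply: ler_sum => t _; rewrite rnormZ rnormV !rnormX w1 !expr1n invr1 mul1r.
by apply: hB; rewrite rnormX w1 expr1n.
Qed.

Variable L : R.
Hypothesis L1 : 1 <= L.
Hypothesis TL : kreiss_resolvents L.

Lemma iter_bound (M : R) : 0 <= M -> (forall x, rnorm (T x) <= M * rnorm x) ->
  forall n x, rnorm (iter n T x) <= M ^+ n * rnorm x.
Proof.
move=> M0 TM; elim=> [|n IH] x; first by rewrite expr0 mul1r.
by rewrite iterS exprS -mulrA; apply: le_trans (TM _) _; rewrite ler_wpM2l.
Qed.

(** At l = (a + 1) / z one has a + 1 - zT = z (l - T) and |l| - 1 = a. By [geo_resolvent], z^k times
    the operator is a^k q(zT)^k S^k with q = 1 - (X / (a + 1))^Q. The factor a^k cancels the Kreiss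
    bound L / a^k, and q(zT) has norm at most 1 + 2^-Q since T has norm at most (a + 1)/2. *)
Lemma op_geo_bound (a Q k : nat) (z : R[i]) (y : V) :
  (0 < a)%N -> (0 < k)%N -> rnorm z = 1 ->
  (forall x, rnorm (T x) <= a.+1%:R / 2 * rnorm x) ->
  rnorm (op T (geo a Q ^+ k) z y) <= L * (1 + 2^-1 ^+ Q) ^+ k * rnorm y.
Proof.
move=> a0 k0 z1 Ta.
have zn0 : z != 0 by exact: unimodular_neq0.
have A0 : 0 < a.+1%:R :> R by rewrite ltr0n.
have ar0 : 0 < a%:R :> R by rewrite ltr0n.
have rl : rnorm ((a.+1%:R%:C)%C / z) = a.+1%:R.
  by rewrite rnormM rnormV z1 invr1 mulr1 rnormR// ltW.
have [|S [ST Sk]] := TL (l := (a.+1%:R%:C)%C / z); first by rewrite rl ltr1n.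
pose h : {poly R} := a.+1%:R%:P - 'X.
have hE x : op T h z x = z *: (((a.+1%:R%:C)%C / z) *: x - T x).
  rewrite (@opE _ _ _ 2); last first.
    by rewrite (leq_trans (size_polyD _ _))// size_polyN size_polyX geq_max (leq_trans (size_polyC_leq1 _)).
  rewrite big_ord_recl big_ord1/= !coefB !coefC !coefX/= subr0 sub0r expr0 mulr1 expr1.
  rewrite scalerBr scalerA [z * _]mulrC divfK// rmorphN rmorph1 mulN1r scaleNr.
  by [].
have hS n x : op T (h ^+ n) z (iter n S x) = z ^+ n *: x.
  elim: n x => [|n IH] x.
    by rewrite !expr0 op1 scale1r.
  by rewrite exprSr opM// hE iterS ST /op act_scaler// -/(op _ _ _ _) IH scalerA -exprS.
have e : geo a Q ^+ k * h ^+ k = a%:R ^+ k *: (1 - (a.+1%:R ^- Q) *: 'X^Q) ^+ k.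
  by rewrite -exprMn geo_resolvent exprZn.
pose q : {poly R} := 1 - (a.+1%:R ^- Q) *: 'X^Q.
have qb x : rnorm (op T q z x) <= (1 + 2^-1 ^+ Q) * rnorm x.
  have qE : op T q z x = x - ((a.+1%:R ^- Q)%:C)%C *: (z ^+ Q *: iter Q T x).
    rewrite /q opD op1; congr (_ + _).
    rewrite -scaleNr opZ rmorphN scaleNr; congr (- (_ *: _)).
    rewrite (@opE _ _ _ Q.+1) ?size_polyXn// (bigD1 ord_max)//= coefXn eqxx mul1r.
    by rewrite big1 ?addr0// => i iQ; rewrite coefXn (negbTE (iQ : val i != Q)) mul0r scale0r.
  rewrite qE mulrDl mul1r; apply: le_trans (ler_rnormD _ _) _; rewrite lerD2l rnormN.
  rewrite rnormZ rnormR; last by rewrite invr_ge0 exprn_ge0// ltW.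
  rewrite rnormZ rnormX z1 expr1n mul1r.
  have := iter_bound (_ : 0 <= a.+1%:R / 2) Ta Q x; rewrite divr_ge0// ?(ltW A0)// => /(_ isT) hb.
  rewrite ler_pdivrMl ?exprn_gt0//; apply: le_trans hb _.
  by rewrite mulrA -exprMn.
have qk n x : rnorm (op T (q ^+ n) z x) <= (1 + 2^-1 ^+ Q) ^+ n * rnorm x.
  elim: n x => [|n IH] x; first by rewrite !expr0 op1 mul1r.
  rewrite exprS opM// exprS -mulrA; apply: le_trans (qb _) _.
  by rewrite ler_wpM2l// addr_ge0// exprn_ge0.
have zk : z ^+ k *: op T (geo a Q ^+ k) z y =
    (((a%:R ^+ k : R)%:C)%C) *: op T (q ^+ k) z (iter k S y).
  by rewrite -opZ -e opM// hS /op act_scaler.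
have -> : rnorm (op T (geo a Q ^+ k) z y) = rnorm (z ^+ k *: op T (geo a Q ^+ k) z y).
  by rewrite rnormZ rnormX z1 expr1n mul1r.
rewrite zk rnormZ rnormR; last by rewrite exprn_ge0// ltW.
apply: le_trans (ler_wpM2l _ (qk _ _)) _; first by rewrite exprn_ge0// ltW.
have := Sk k y k0; rewrite rl -natr1 addrK => hk.
have c0 : 0 <= (1 + 2^-1 ^+ Q) ^+ k :> R by rewrite exprn_ge0// addr_ge0// exprn_ge0.
apply: le_trans (ler_wpM2l _ (ler_wpM2l c0 hk)) _; first by rewrite exprn_ge0// ltW.
apply: ler_eq.
by field; rewrite expf_neq0// gt_eqF.
Qed.

Hypothesis Tbnd : exists M : R, forall x, rnorm (T x) <= M * rnorm x.

Lemma op_bound_exists : exists k0 : nat, (0 < k0)%N /\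
  forall x, rnorm (T x) <= (k0.*2)%:R / 2 * rnorm x.
Proof.
have [M TM] := Tbnd.
exists (Num.bound M).+1; split=> // x; apply: le_trans (TM x) _.
rewrite ler_wpM2r ?rnorm_ge0// -mul2n natrM mulrAC divff ?mul1r//.
have [M0|M0] := leP 0 M; last by apply: le_trans (ltW M0) _.
by apply: le_trans (ltW (archi_boundP M0)) _; rewrite ler_nat.
Qed.

Lemma pow2_large (k : nat) : exists Q, (1 < Q)%N /\ (4 * k * Q.+1 <= 2 ^ Q)%N.
Proof.
have key m : (3 <= m)%N -> (m.*2.+1 <= 2 ^ m)%N.
  elim: m => // m IH; rewrite leq_eqVlt => /predU1P[<-//|m3].
  by have := IH m3; rewrite expnS; lia.
exists (4 * k + 3).*2; split; first by lia.
rewrite -addnn expnD addnn leq_mul//.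
  by apply: leq_trans (ltnW (ltn_expl _ (ltnSn 1))); lia.
by apply: key; lia.
Qed.

Lemma exprn_1Dle2 (x : R) (k : nat) : 0 <= x -> 2 * k%:R * x <= 1 -> (1 + x) ^+ k <= 2.
Proof.
move=> x0 kx; suff h n : (n <= k)%N -> (1 + x) ^+ n <= 1 + 2 * n%:R * x.
  by apply: le_trans (h k (leqnn k)) _; lra.
elim: n => [|n IH] nk; first by rewrite expr0 mulr0 mul0r addr0.
have {}IH := IH (ltnW nk).
have nkx : 2 * n%:R * x <= 1.
  by apply: le_trans kx; rewrite ler_wpM2r// ler_wpM2l// ler_nat ltnW.
have n0 : 0 <= n%:R :> R by [].
rewrite exprS -natr1; apply: (@le_trans _ _ ((1 + x) * (1 + 2 * n%:R * x))).
  by rewrite ler_wpM2l// addr_ge0.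
nra.
Qed.

(** The negative binomial law with k = a g has mean about [g]. Here a + 1 is at least twice an a
    priori bound for the norm of T and [Q] is large depending on [a] and [g]; neither enters the
    final bounds. *)
Lemma weight_exists (g : nat) : exists G : {poly R},
  [/\ forall i, 0 <= G`_i,
      forall z x, rnorm z = 1 -> rnorm (op T G z x) <= 2 * L * rnorm x &
      forall r : nat, (12 * g <= r ^ 2)%N ->
        2^-1 <= \sum_(i < size G | (i <= g + r)%N && (g <= i + r)%N) G`_i].
Proof.
have L0 : 0 <= L := le_trans ler01 L1.
have [->|g0] := posnP g.
  exists 1; split=> [i|z x z1|r _].
  - by rewrite coefC; case: ifP.
  - rewrite op1 ler_peMl ?rnorm_ge0//; move: L1; lra.
  - rewrite size_poly1 big_mkcond big_ord1 coefC/=; lra.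
have [k0 [k00 Tk]] := op_bound_exists.
pose a := (k0.*2).-1; have aE : (a.+1 = k0.*2)%N by rewrite prednK// double_gt0.
have a0 : (0 < a)%N by rewrite /a; lia.
have [Q [Q1 hQ]] := pow2_large (a * g).
exists (geo a Q ^+ (a * g)); split=> [i|z x z1|r hr].
- exact: geo_ge0.
- apply: le_trans (op_geo_bound Q _ _ _ z1 _) _ => //; rewrite ?muln_gt0 ?a0//.
    by move=> y; rewrite aE.
  rewrite ler_wpM2r ?rnorm_ge0// mulrC ler_wpM2r//.
  apply: exprn_1Dle2; first by rewrite exprn_ge0.
  rewrite exprVn ler_pdivrMr ?exprn_gt0// mul1r -natrX -!natrM ler_nat.
  by apply: leq_trans hQ; nia.
- apply: geo_concentration => //.
  rewrite -!natrM -natrX ler_nat; apply: leq_trans hQ _.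
  by rewrite leq_exp2r//; lia.
Qed.

(** Makes later constants depend on [L] only: a weight with norm bound 2 L has coefficient at least
    1/8 at T itself. *)
Lemma kreiss_norm_bound x : rnorm (T x) <= 16 * L * rnorm x.
Proof.
have [k0 [k00 Tk]] := op_bound_exists.
pose a := (k0.*2).-1; have aE : (a.+1 = k0.*2)%N by rewrite prednK// double_gt0.
have a0 : (0 < a)%N by rewrite /a; lia.
have [Q [Q1 hQ]] := pow2_large k0.
have L0 : 0 <= L := le_trans ler01 L1.
have := @op_coef_bound (geo a Q ^+ k0) (2 * L * rnorm x) x 1 (geo_ge0 _ _ _ _).
have c1 : 8^-1 <= (geo a Q ^+ k0)`_1 :> R by apply: geo_coef1 => //; rewrite aE mul2n.
move=> h; have {}h := h _.
have : 8^-1 * rnorm (T x) <= 2 * L * rnorm x.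
  apply: le_trans (h _); first by rewrite ler_wpM2r ?rnorm_ge0.
  move=> z z1; apply: le_trans (op_geo_bound Q _ _ k00 z1 _) _ => //.
    by move=> y; rewrite aE.
  rewrite ler_wpM2r ?rnorm_ge0// mulrC ler_wpM2r//.
  apply: exprn_1Dle2; first by rewrite exprn_ge0.
  rewrite exprVn ler_pdivrMr ?exprn_gt0// mul1r -natrX -!natrM ler_nat.
  by apply: leq_trans hQ; nia.
by lra.
Qed.

End weights.

(** * The recursion on scales *)

(** All terms of the convolution are nonnegative, and those in the window of [G] meet coefficients
    of [b] that are at least 1. *)
Lemma coefM_ge_half (R : realType) (G b : {poly R}) (g r m : nat) :
  (forall i, 0 <= G`_i) -> (forall i, 0 <= b`_i) ->
  2^-1 <= \sum_(i < size G | (i <= g + r)%N && (g <= i + r)%N) G`_i ->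
  (forall i, (i <= g + r)%N -> (g <= i + r)%N -> (i <= m)%N /\ 1 <= b`_(m - i)) ->
  2^-1 <= (G * b)`_m.
Proof.
move=> G0 b0 hG hb; apply: le_trans hG _; rewrite coefM.
pose W := maxn (size G) m.+1.
rewrite (big_ord_widen_cond W (fun i => (i <= g + r)%N && (g <= i + r)%N)
  (fun i => G`_i)) ?leq_maxl//.
rewrite (big_ord_widen W (fun i => G`_i * b`_(m - i))) ?leq_maxr//.
rewrite big_mkcond [leRHS]big_mkcond/=; apply: ler_sum => i _.
case: ifP => [/andP[/andP[h1 h2] _]|_]; last by case: ifP => // _; rewrite mulr_ge0.
have [im bi] := hb i h1 h2.
by rewrite ltnS im ler_peMr.
Qed.

(** Here c l is the multiple of [l] nearest to [m]. A weight centred at c l - 21 l with radius 6 l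
    leaves m - j within 6 l + l/2 of 21 l, hence inside [14 l, 28 l], where the polynomial of the
    previous scale is at least 1. As c < 2 l + 5, the centre is below 3 l^2, which is what
    concentration at radius 6 l asks for. *)
Lemma window_center (l N m : nat) : (21 <= l)%N -> (l ^ 2 <= N < l.+1 ^ 2)%N ->
  (N <= m <= N.*2)%N -> exists c,
  [/\ (l <= c < l + (l + 5))%N, (m <= c * l + l./2)%N, (c * l <= m + l./2)%N,
      (12 * (c * l - 21 * l) <= (6 * l) ^ 2)%N &
      forall j, (j <= c * l - 21 * l + 6 * l)%N -> (c * l - 21 * l <= j + 6 * l)%N ->
        (j <= m)%N /\ (14 * l <= m - j <= (14 * l).*2)%N].
Proof.
move=> l21; rewrite expnMn -!mulnn => /andP[lN Nl] /andP[Nm mN].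
have l0 : (0 < l)%N by exact: leq_trans l21.
exists ((m + l./2) %/ l)%N; set c := (_ %/ l)%N.
have hc : (m + l./2 = c * l + (m + l./2) %% l)%N by exact: divn_eq.
have hr : ((m + l./2) %% l < l)%N by exact: ltn_pmod.
move: ((m + l./2) %% l)%N hc hr => r hc hr.
have lc : (l <= c)%N by rewrite /c leq_divRL// (leq_trans lN)// (leq_trans Nm)// leq_addr.
have cu : (c < l + (l + 5))%N by rewrite /c ltn_divLR//; nia.
have h21 : (21 * l <= c * l)%N by rewrite leq_mul2r (leq_trans l21 lc) orbT.
have hcl : (c * l <= 2 * (l * l) + 4 * l)%N.
  by rewrite mulnA -mulnDl leq_mul2r; apply/orP; right; move: cu; lia.
have hll : (21 * l <= l * l)%N by rewrite leq_mul2r l21 orbT.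
clearbody c; move: (c * l)%N (l * l)%N h21 hcl hll hc => cl ll h21 hcl hll hc.
rewrite lc cu; split=> //; [lia|lia| |].
- by move: hcl hll; lia.
- by move=> j j1 j2; lia.
Qed.

Lemma central_window (l M : nat) : (42 <= l)%N -> (l ^ 2 <= M < l.+1 ^ 2)%N ->
  (42 * l <= M)%N /\ (12 * (M - 42 * l) <= (6 * l) ^ 2)%N.
Proof. by move=> l42; rewrite expnMn -!mulnn => /andP[lM Ml]; split; nia. Qed.

Section levels.
Context {R : realType} {V : normedModType R[i]} (T : V -> V) (p : R).

(* The last two conditions bound x |-> (b(zT)x)_z : V -> L^p(V) and
   f |-> avg_z b(zT)f(z) : L^p(V) -> V by Lam^(1/p), where z runs over the D-th
   roots of unity with the uniform probability. *)
Definition level (n : nat) (Lam : R) : Prop := exists D0 : nat,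
  forall (D : nat) (w : R[i]), (D0 <= D)%N -> D.-primitive_root w ->
  exists b : {poly R}, [/\ forall i, 0 <= b`_i, (size b <= D0)%N,
    forall i, (n <= i <= n.*2)%N -> 1 <= b`_i,
    forall x, \sum_(t < D) rnorm (op T b (w ^+ t) x) `^ p <=
       D%:R * Lam * rnorm x `^ p &
    forall f : 'I_D -> V, rnorm (\sum_(t < D) op T b (w ^+ t) (f t)) `^ p <=
       D%:R `^ (p - 1) * Lam * \sum_(t < D) rnorm (f t) `^ p].

Lemma level_le n (Lam Lam' : R) : Lam <= Lam' -> level n Lam -> level n Lam'.
Proof.
move=> LL [D0 h]; exists D0 => D w D0D wp.
have [b [b0 sb b1 bB bA]] := h D w D0D wp; exists b; split=> // [x|f].
  by apply: le_trans (bB x) _; rewrite ler_wpM2r ?powR_ge0// ler_wpM2l.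
apply: le_trans (bA f) _; rewrite ler_wpM2r ?ler_wpM2l ?powR_ge0//.
by rewrite sumr_ge0// => t _; rewrite powR_ge0.
Qed.

Hypothesis Tlin : linear T.
Hypothesis p1 : 1 < p.

Let p0 : 0 < p. Proof. by move: p1; lra. Qed.

(** The triangle inequality for the indicator of [n, 2n]. The bound is exponential in [n] and serves
    only below a fixed scale. *)
Lemma level_base (M : R) (n : nat) : 1 <= M -> (forall x, rnorm (T x) <= M * rnorm x) ->
  level n (((n.*2.+1)%:R * M ^+ n.*2) `^ p).
Proof.
move=> M1 TM; have M0 : 0 <= M := le_trans ler01 M1.
set Gam := _ * _; have Gam0 : 0 <= Gam by rewrite mulr_ge0// exprn_ge0.
exists n.*2.+1 => D w _ wp.
pose b : {poly R} := \poly_(i < n.*2.+1) (n <= i)%:R.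
have sb : (size b <= n.*2.+1)%N by exact: size_poly.
have w1 := prim_root_rnorm wp.
have hb t x : rnorm (op T b (w ^+ t) x) <= Gam * rnorm x.
  rewrite (opE _ _ _ sb); apply: le_trans (ler_rnorm_sum _ _ _) _.
  have -> : Gam * rnorm x = \sum_(i < n.*2.+1) M ^+ n.*2 * rnorm x.
    by rewrite sumr_const card_ord -mulr_natl mulrA.
  apply: ler_sum => i _; rewrite rnormZ rnormM !rnormX w1 !expr1n mulr1.
  rewrite coef_poly ltn_ord rnormR//.
  have h1 : rnorm (iter i T x) <= M ^+ n.*2 * rnorm x.
    apply: le_trans (iter_bound M0 TM i x) _; rewrite ler_wpM2r ?rnorm_ge0//.
    by rewrite ler_weXn2l// -ltnS.
  by case: (n <= i)%N; rewrite ?mul1r// mul0r mulr_ge0 ?exprn_ge0 ?rnorm_ge0.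
exists b; split=> //.
- by move=> i; rewrite coef_poly; case: ifP.
- by move=> i /andP[ni i2]; rewrite coef_poly ltnS i2 ni.
- move=> x; have -> : D%:R * Gam `^ p * rnorm x `^ p = \sum_(t < D) (Gam * rnorm x) `^ p.
    by rewrite sumr_const card_ord powRM ?rnorm_ge0// -mulrA mulr_natl.
  apply: ler_sum => t _.
  by apply: (ge0_ler_powR (ltW p0)) => //; rewrite nnegrE ?rnorm_ge0// mulr_ge0 ?rnorm_ge0.
- move=> f; apply: (@le_trans _ _ ((\sum_(t < D) Gam * rnorm (f t)) `^ p)).
    apply: (ge0_ler_powR (ltW p0)); rewrite ?nnegrE ?rnorm_ge0//.
      by rewrite sumr_ge0// => t _; rewrite mulr_ge0 ?rnorm_ge0.
    by apply: le_trans (ler_rnorm_sum _ _ _) _; apply: ler_sum => t _; exact: hb.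
  rewrite -mulr_sumr powRM//; last by rewrite sumr_ge0// => t _; exact: rnorm_ge0.
  rewrite [D%:R `^ _ * _]mulrC -mulrA ler_wpM2l ?powR_ge0//.
  have := @powR_sum_le R _ (fun t : 'I_D => rnorm (f t)) p (ltW p1).
  by rewrite card_ord; apply => t; exact: rnorm_ge0.
Qed.

(** [fejer_mode] on each coefficient: cutting a polynomial by a tent is averaging its values on the
    roots of unity. *)
Lemma op_window (D l S a : nat) (w : R[i]) (h : {poly R}) (t : 'I_D) (x : V) :
  D.-primitive_root w -> (0 < l)%N -> (size h <= S)%N ->
  op T (\poly_(m < S) (tent D l a m * h`_m)) (w ^+ t) x =
  \sum_(u < D) (((fejer l w t u)%:C)%C * twist w t u ^+ a) *: op T h (w ^+ u) x.
Proof.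
move=> wp l0 hS; rewrite (opE _ _ _ (size_poly _ _)).
under [RHS]eq_bigr do rewrite (opE _ _ _ hS) scaler_sumr.
rewrite exchange_big/=; apply: eq_bigr => m _.
under eq_bigr do rewrite scalerA.
rewrite -scaler_suml; congr (_ *: _).
rewrite coef_poly ltn_ord rmorphM/=.
under eq_bigr do rewrite mulrCA.
by rewrite -mulr_sumr fejer_mode// mulrCA mulrA.
Qed.

Variable L : R.
Hypothesis L1 : 1 <= L.
Hypothesis V_ext : lp_extension V p.
Hypothesis TW : forall g : nat, exists G : {poly R},
  [/\ forall i, 0 <= G`_i,
      forall z x, rnorm z = 1 -> rnorm (op T G z x) <= 2 * L * rnorm x &
      forall r : nat, (12 * g <= r ^ 2)%N ->
        2^-1 <= \sum_(i < size G | (i <= g + r)%N && (g <= i + r)%N) G`_i].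

Let L0 : 0 <= L. Proof. exact: le_trans ler01 L1. Qed.

(** Each of the K = l + 5 centres y_i, consecutive multiples of [l], receives the window b G_i cut
    by its tent; the new polynomial is 4 times the sum. Applying G_i costs 2 L, whence 8 L. Gluing
    is [synthesis] for the first estimate and [analysis] for the second. *)
Lemma level_step (l N : nat) (Lam : R) : (21 <= l)%N -> (l ^ 2 <= N < l.+1 ^ 2)%N ->
  0 <= Lam -> level (14 * l) Lam ->
  level N ((8 * L) `^ p * (l + 5)%:R `^ (1 + Num.max 0 (p - 2)) * Lam).
Proof.
move=> l21 lNl Lam0 [D0 hD0].
have l0 : (0 < l)%N by exact: leq_trans l21.
pose K := (l + 5)%N; pose y (i : 'I_K) := (l * (l + i))%N.
have K0 : 0 < K%:R :> R by rewrite ltr0n /K; lia.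
have [G HG] := boolp.choice (fun i : 'I_K => TW (y i - 21 * l)).
have G0 i j : 0 <= (G i)`_j by have [h _ _] := HG i; exact: h.
have GL i z x : rnorm z = 1 -> rnorm (op T (G i) z x) <= 2 * L * rnorm x.
  by move=> z1; have [_ h _] := HG i; exact: h.
(* [S] bounds the sizes of all the products [b * G i] uniformly in [D]. The additional
   [l * (2 * l + 6)] below keeps the windows from wrapping modulo [D]. *)
pose S := (D0 + \sum_i size (G i))%N.
exists (S + l * (2 * l + 6))%N => D w SD wp.
have [|b [b0 sb b1 bB bA]] := hD0 D w _ wp; first by apply: leq_trans SD; rewrite /S -addnA leq_addr.
pose h i := b * G i.
have hE i : h i = G i * b by rewrite /h mulrC.
have sh i : (size (h i) <= S)%N.
  apply: leq_trans (size_polyMleq _ _) _; rewrite /S (bigD1 i)//=.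
  by apply: leq_trans (leq_pred _) _; rewrite addnA (leq_trans _ (leq_addr _ _))// leq_add2r.
have h0 i m : 0 <= (h i)`_m by rewrite coefM sumr_ge0// => j _; rewrite mulr_ge0.
pose q i : {poly R} := \poly_(m < S) (tent D l (y i) m * (h i)`_m).
have qE i m : (q i)`_m = tent D l (y i) m * (h i)`_m.
  rewrite coef_poly; case: ltnP => // Sm.
  by rewrite [(h i)`_m]nth_default ?mulr0// (leq_trans (sh i)).
have q0 i m : 0 <= (q i)`_m by rewrite qE mulr_ge0// tent_ge0.
have w1 := prim_root_rnorm wp.
have wt1 (t : nat) : rnorm (w ^+ t) = 1 by rewrite rnormX w1 expr1n.
pose chi (i : 'I_K) (t u : 'I_D) : R[i] := twist w t u ^+ y i.
have chi1 i t u : rnorm (chi i t u) = 1 by rewrite rnormX (twist1 wp) expr1n.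
have t00 : tent D l 0 0 = 1 :> R.
  have l1D : (l * 1 <= D)%N.
    by apply: leq_trans SD; rewrite (leq_trans _ (leq_addl _ _))// leq_mul2l addnS orbT.
  by have := @tent_orth R D l l0 0 0 l1D l1D; rewrite muln0.
have kap_row (t : 'I_D) : \sum_u fejer l w t u = 1.
  apply: complexI; rewrite rmorph_sum/= -t00 -(fejer_row l wp t 0 0).
  by apply: eq_bigr => u _; rewrite expr0 invr1 !mulr1.
have kap_col (u : 'I_D) : \sum_t fejer l w t u = 1.
  apply: complexI; rewrite rmorph_sum/= -t00 -(fejer_col l wp u 0 0).
  by apply: eq_bigr => t _; rewrite expr0 invr1 !mulr1.
have yD (i : 'I_K) : (l * (l + i).+1 <= D)%N.
  apply: leq_trans SD; apply: leq_trans (leq_addl _ _).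
  rewrite leq_mul2l; apply/orP; right; apply: leq_trans (_ : _ <= l + K)%N _.
    by rewrite ltn_add2l.
  by rewrite /K addnA addnn -mul2n leq_add2l.
have chi_orth u i k :
    \sum_t ((fejer l w t u)%:C)%C * (chi i t u * (chi k t u)^*%C) = (i == k)%:R.
  under eq_bigr do rewrite unimodular_conj//.
  rewrite (fejer_col l wp) (tent_orth l0 (yD i) (yD k)) rmorph_nat.
  by rewrite eqn_add2l.
have kap0 (t u : 'I_D) : 0 <= fejer l w t u by exact: fejer_ge0.
have opq (t : 'I_D) x : op T (4 *: \sum_i q i) (w ^+ t) x = ((4%:C)%C) *: \sum_i \sum_u
    (((fejer l w t u)%:C)%C * chi i t u) *: op T (h i) (w ^+ u) x.
  rewrite opZ op_sum; congr (_ *: _); apply: eq_bigr => i _.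
  by rewrite op_window.
have [p4L p4] : 0 <= 2 * L /\ 0 <= 4 :> R by split; [move: L0; lra|].
have e8 : (8 * L) `^ p = 4 `^ p * (2 * L) `^ p.
  by rewrite -powRM//; congr (_ `^ _); ring.
have KK : K%:R `^ (1 + Num.max 0 (p - 2)) = K%:R * K%:R `^ Num.max 0 (p - 2) :> R.
  by rewrite powRD ?powRr1 ?(ltW K0)//; apply/implyP => _; rewrite gt_eqF.
have cK : #|'I_K| = K by rewrite card_ord.
exists (4 *: \sum_i q i); split.
- by move=> m; rewrite coefZ coef_sum mulr_ge0// sumr_ge0.
- apply: leq_trans (size_scale_leq _ _) _; apply: leq_trans (leq_addr _ _).
  apply: leq_trans (size_sum _ _ _) _; apply/bigmax_leqP => i _; exact: size_poly.
- move=> m /andP[Nm mN].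
  have [|c [/andP[lc cu] my ym hg win]] := window_center l21 lNl (_ : N <= m <= _)%N.
    by rewrite Nm.
  have cK' : (c - l < K)%N by rewrite ltn_subLR.
  pose i : 'I_K := Ordinal cK'.
  have yi : y i = (c * l)%N by rewrite /y /= subnKC// mulnC.
  rewrite -yi in my ym hg win.
  (* The origin of the factor 4: the tent keeps one half, and so does the mass of the weight in its
     window. *)
  have hq : 4^-1 <= (q i)`_m.
    rewrite qE (_ : 4^-1 = 2^-1 * 2^-1); last by field.
    rewrite ler_pM// ?invr_ge0//; first exact: (tent_ge_half wp l0 my ym).
    rewrite hE; have [_ _ /(_ (6 * l)%N) mass] := HG i.
    apply: (coefM_ge_half (G0 i) b0 (mass hg)) => j j1 j2.
    by have [jm hj] := win j j1 j2; split=> //; exact: b1.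
  rewrite coefZ coef_sum (bigD1 i)//= mulrDr.
  have : 0 <= 4 * \sum_(k < K | k != i) (q k)`_m by rewrite mulr_ge0// sumr_ge0.
  by lra.
- move=> x; under eq_bigr do rewrite opq rnormZ rnormR// powRM ?rnorm_ge0//.
  rewrite -mulr_sumr.
  apply: le_trans (ler_wpM2l (powR_ge0 _ _)
    (synthesis kap0 kap_row kap_col chi1 chi_orth p1 V_ext _)) _.
  rewrite cK e8 KK.
  apply: (@le_trans _ _ (4 `^ p * (K%:R `^ Num.max 0 (p - 2) *
     \sum_(i < K) ((2 * L) `^ p * (D%:R * Lam * rnorm x `^ p))))).
    rewrite ler_wpM2l ?powR_ge0// ler_wpM2l ?powR_ge0//; apply: ler_sum => i _.
    apply: le_trans (_ : _ <= (2 * L) `^ p * \sum_(u < D) rnorm (op T b (w ^+ u) x) `^ p) _.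
      rewrite mulr_sumr; apply: ler_sum => u _.
      rewrite hE opM// -powRM ?rnorm_ge0//.
      by apply: (ge0_ler_powR (ltW p0)); rewrite ?nnegrE ?mulr_ge0 ?rnorm_ge0 ?GL.
    by rewrite ler_wpM2l ?powR_ge0.
  rewrite sumr_const card_ord -[_ *+ K]mulr_natl.
  by apply: ler_eq; ring.
- move=> f.
  (* Exchanging the sums moves the kernel from the operators to [f]; [F] collects the coefficients
     that [analysis] controls. *)
  pose F i (u : 'I_D) := \sum_t (((fejer l w t u)%:C)%C * chi i t u) *: f t.
  have -> : \sum_(t < D) op T (4 *: \sum_i q i) (w ^+ t) (f t) =
      ((4%:C)%C) *: \sum_i \sum_(u < D) op T b (w ^+ u) (op T (G i) (w ^+ u) (F i u)).
    under eq_bigr do rewrite opq.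
    rewrite -scaler_sumr; congr (_ *: _).
    rewrite exchange_big/=; apply: eq_bigr => i _.
    rewrite exchange_big/=; apply: eq_bigr => u _.
    rewrite -opM// -/(h i) /F /op act_sumr//; apply: eq_bigr => t _.
    by rewrite act_scaler.
  rewrite rnormZ rnormR// powRM ?rnorm_ge0//.
  apply: (@le_trans _ _ (4 `^ p * (K%:R `^ (p - 1) * \sum_(i < K)
      (D%:R `^ (p - 1) * Lam * ((2 * L) `^ p * \sum_(u < D) rnorm (F i u) `^ p))))).
    rewrite ler_wpM2l ?powR_ge0//.
    apply: (@le_trans _ _ ((\sum_(i < K) rnorm (\sum_(u < D)
         op T b (w ^+ u) (op T (G i) (w ^+ u) (F i u)))) `^ p)).
      apply: (ge0_ler_powR (ltW p0)); rewrite ?nnegrE ?rnorm_ge0 ?ler_rnorm_sum//.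
      by rewrite sumr_ge0// => i _; rewrite rnorm_ge0.
    apply: le_trans (powR_sum_le (ltW p1) _) _; first by move=> i; rewrite rnorm_ge0.
    rewrite cK ler_wpM2l ?powR_ge0//; apply: ler_sum => i _.
    apply: le_trans (bA _) _; rewrite ler_wpM2l ?mulr_ge0 ?powR_ge0//.
    rewrite mulr_sumr; apply: ler_sum => u _; rewrite -powRM ?rnorm_ge0//.
    by apply: (ge0_ler_powR (ltW p0)); rewrite ?nnegrE ?mulr_ge0 ?rnorm_ge0 ?GL.
  rewrite -!mulr_sumr.
  have := analysis kap0 kap_row kap_col chi1 chi_orth p1 V_ext f; rewrite cK => han.
  (* Here the K^(p-1) comes from the power mean over the windows; both estimates thus lose the same
     power of K. *)
  have e : K%:R `^ (1 + Num.max 0 (p - 2)) = K%:R `^ (p - 1) * K%:R `^ Num.max 0 (2 - p) :> R.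
    rewrite -powRD; last by apply/implyP => _; rewrite gt_eqF.
    congr (_ `^ _); have [p2|p2] := leP p 2.
      by rewrite max_l ?max_r; move: p2; lra.
    by rewrite max_r ?max_l; move: p2; lra.
  rewrite e8 e.
  set X := \sum_(i < K) _ in han *; set Y := \sum_t _ in han *.
  apply: (@le_trans _ _ (4 `^ p * (K%:R `^ (p - 1) *
    (D%:R `^ (p - 1) * Lam * ((2 * L) `^ p * (K%:R `^ Num.max 0 (2 - p) * Y)))))).
    rewrite !ler_wpM2l ?powR_ge0 ?mulr_ge0 ?powR_ge0//.
  by apply: ler_eq; ring.
Qed.

(** T^M is read off from b G b: the outer [b] uses the second estimate of [level], [G] costs 2 L and
    the inner [b] uses the first. The powers of [D] combine to D^p and cancel, which leaves Lam^2
    under the p-th root. *)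
Lemma level_power_bound (l M : nat) (Lam : R) (x : V) : (42 <= l)%N ->
  (l ^ 2 <= M < l.+1 ^ 2)%N -> 0 <= Lam -> level (14 * l) Lam ->
  l%:R / 2 * rnorm (iter M T x) <= 2 * L * Lam `^ (2 / p) * rnorm x.
Proof.
move=> l42 lMl Lam0 [D0 hD0].
have [M42 hg] := central_window l42 lMl.
have [G [G0 GL mass]] := TW (M - 42 * l).
pose D := (2 * D0 + size G + M).+1.
have [w wp] := @prim_root_exists R D isT.
have [|b [b0 sb b1 bB bA]] := hD0 D w _ wp; first by rewrite /D; lia.
have w1 := prim_root_rnorm wp.
have wt1 (t : nat) : rnorm (w ^+ t) = 1 by rewrite rnormX w1 expr1n.
pose h := b * (G * b).
have hD : (size h <= D)%N.
  apply: leq_trans (size_polyMleq _ _) _.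
  by have := size_polyMleq G b; rewrite /D; lia.
(* The [l] indices j in [21 l, 22 l[ contribute at least 1/2 each: the weight centred at M - 42 l
   with radius 6 l leaves an index in [14 l, 28 l] for the second [b]. *)
have hM : l%:R / 2 <= h`_M.
  rewrite coefM -(big_mkord xpredT (fun j => b`_j * (G * b)`_(M - j))).
  have nn j : 0 <= b`_j * (G * b)`_(M - j).
    by rewrite mulr_ge0// coefM sumr_ge0// => k _; rewrite mulr_ge0.
  rewrite (@big_cat_nat _ _ _ (21 * l))//=; last by rewrite (leq_trans _ (leqnSn _))// (leq_trans _ M42)// leq_mul2r orbT.
  rewrite (@big_cat_nat _ _ _ (22 * l) (21 * l))//=; [|by rewrite leq_mul2r orbT|
    by rewrite (leq_trans _ (leqnSn _))// (leq_trans _ M42)// leq_mul2r orbT].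
  apply: (@le_trans _ _ (\sum_(21 * l <= j < 22 * l) 2^-1)).
    rewrite sumr_const_nat -[_ *+ (22 * l - _)]mulr_natl -mulnBl mul1n//.
  apply: (@le_trans _ _ (\sum_(21 * l <= j < 22 * l) b`_j * (G * b)`_(M - j))).
    rewrite !big_nat; apply: ler_sum => j /andP[j1 j2].
    have bj : 1 <= b`_j by apply: b1; lia.
    have gb : 2^-1 <= (G * b)`_(M - j).
      apply: (coefM_ge_half G0 b0 (mass (6 * l)%N hg)) => i i1 i2.
      clear -M42 i1 i2 j1 j2 b1; split; [lia|apply: b1; lia].
    by rewrite -[leLHS]mul1r ler_pM// invr_ge0.
  by rewrite addrCA lerDl addr_ge0 ?sumr_ge0.
have D0' : 0 < D%:R :> R by rewrite ltr0n.
have hM0 : 0 <= h`_M by apply: le_trans hM; rewrite divr_ge0.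
have := extraction T x wp hD (_ : M < D)%N => /(_ ltac:(by rewrite /D; lia)) E.
pose f (t : 'I_D) := ((w ^+ t) ^+ M)^-1 *: op T G (w ^+ t) (op T b (w ^+ t) x).
have {}E : \sum_(t < D) op T b (w ^+ t) (f t) =
    (D%:R * ((h`_M)%:C)%C) *: iter M T x.
  rewrite -E; apply: eq_bigr => t _.
  by rewrite /h /f !opM// /op act_scaler.
have E2 := bA f; rewrite E in E2.
have fB : \sum_t rnorm (f t) `^ p <= (2 * L) `^ p * (D%:R * Lam * rnorm x `^ p).
  apply: le_trans (_ : _ <= (2 * L) `^ p * \sum_(u < D) rnorm (op T b (w ^+ u) x) `^ p) _.
    rewrite mulr_sumr; apply: ler_sum => u _.
    rewrite -powRM ?rnorm_ge0//; last by move: L0; lra.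
    apply: (ge0_ler_powR (ltW p0)); rewrite ?nnegrE ?mulr_ge0 ?rnorm_ge0//.
    by rewrite rnormZ rnormV rnormX wt1 expr1n invr1 mul1r GL.
  by rewrite ler_wpM2l ?powR_ge0.
have rD : rnorm (D%:R : R[i]) = D%:R.
  by rewrite -(rmorph_nat (real_complex R)) rnormR// ltW.
rewrite rnormZ rnormM (rnormR hM0) rD in E2.
have {}E2 : (D%:R * h`_M * rnorm (iter M T x)) `^ p <=
   (D%:R * (2 * L * Lam `^ (2 / p) * rnorm x)) `^ p.
  apply: le_trans E2 _.
  apply: le_trans (ler_wpM2l _ fB) _; first by rewrite mulr_ge0 ?powR_ge0.
  have LL : Lam * Lam = (Lam `^ (2 / p)) `^ p.
    rewrite -powRrM divfK ?gt_eqF//.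
    by rewrite -[2]/(2%:R) powR_mulrn.
  have DD : D%:R `^ (p - 1) * D%:R = D%:R `^ p :> R.
    by rewrite mulrC mulr_powRB1.
  rewrite !powRM ?mulr_ge0 ?powR_ge0 ?rnorm_ge0//.
  by rewrite -LL -DD; apply: ler_eq; ring.
have {}E2 : D%:R * h`_M * rnorm (iter M T x) <= D%:R * (2 * L * Lam `^ (2 / p) * rnorm x).
  rewrite leNgt; apply/negP => lt.
  suff : (D%:R * (2 * L * Lam `^ (2 / p) * rnorm x)) `^ p < (D%:R * h`_M * rnorm (iter M T x)) `^ p.
    by rewrite ltNge E2.
  by apply: gt0_ltr_powR => //; rewrite nnegrE !mulr_ge0 ?powR_ge0 ?rnorm_ge0.
rewrite -mulrA ler_pM2l// in E2.
by apply: le_trans E2; rewrite ler_wpM2r ?rnorm_ge0.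
Qed.

End levels.

(** * Growth of the powers *)

Lemma nat_sqrt (N : nat) : exists l, (l ^ 2 <= N < l.+1 ^ 2)%N.
Proof.
elim: N => [|N [l /andP[lN Nl]]]; first by exists 0%N.
have [h|h] := ltnP N.+1 (l.+1 ^ 2); first by exists l; rewrite h (leq_trans lN).
exists l.+1; rewrite h /=; apply: leq_ltn_trans Nl _.
by rewrite ltn_exp2r.
Qed.

(** Bernoulli's inequality for (8/7)^k. The [k] found becomes the power of the logarithm that
    absorbs the constant lost at each change of scale. *)
Lemma geometric_small (R : realType) (A : R) : 0 <= A ->
  exists k : nat, (0 < k)%N /\ A * (7 / 8) ^+ k <= 1.
Proof.
move=> A0; exists (Num.bound (7 * A)).+1; split=> //.
set k := (Num.bound _).+1.
have bern n : 1 + n%:R / 7 <= (8 / 7) ^+ n :> R.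
  elim: n => [|n IH]; first by rewrite mul0r addr0 expr0.
  have n0 : 0 <= n%:R :> R by [].
  by rewrite exprS -natr1; move: IH; lra.
have Ak : 7 * A <= k%:R.
  apply: le_trans (ltW (archi_boundP _)) _; first by rewrite mulr_ge0.
  by rewrite ler_nat /k leqnSn.
have -> : (7 / 8) ^+ k = ((8 / 7) ^+ k)^-1 :> R by rewrite -exprVn invf_div.
rewrite ler_pdivrMr ?mul1r; last by rewrite exprn_gt0.
by apply: le_trans (bern k); lra.
Qed.

Lemma ln2_ge_half (R : realType) : 2^-1 <= ln 2 :> R.
Proof.
have := @le_ln1Dx R (- 2^-1); rewrite (_ : 1 + - 2^-1 = 2^-1); last by field.
by rewrite lnV ?posrE// => h; have := h ltac:(lra); lra.
Qed.

Lemma ln_natX (R : realType) (m n : nat) : (0 < m)%N -> ln (m ^ n)%:R = n%:R * ln m%:R :> R.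
Proof. by move=> m0; rewrite natrX lnXn ?ltr0n// mulr_natl. Qed.

(** As 196 = 14^2, (14 l)^4 <= l^2 l^4 <= N^3, so ln (14 l) <= 3/4 ln N. Since ln N >= 1, adding 1
    weakens the ratio 3/4 to 7/8. *)
Lemma log_contraction (R : realType) (l N : nat) : (196 <= l)%N -> (l ^ 2 <= N)%N ->
  1 + ln (14 * l)%:R <= 7 / 8 * (1 + ln N%:R) :> R.
Proof.
move=> l196 lN.
have l0 : (0 < l)%N by exact: leq_trans l196.
have N0 : (0 < N)%N by apply: leq_trans lN; rewrite expn_gt0 l0.
have h : 4%:R * ln (14 * l)%:R <= 3%:R * ln N%:R :> R.
  rewrite -!ln_natX ?muln_gt0// ler_ln ?posrE ?ltr0n ?expn_gt0 ?muln_gt0 ?l0 ?N0// ler_nat.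
  apply: (@leq_trans (N * (l ^ 2) ^ 2)%N).
    rewrite (expnM (14 * l) 2 2) (expnMn 14 l 2) expnMn leq_mul//.
    by apply: leq_trans lN; rewrite leq_sqr.
  by rewrite expnS leq_mul// leq_sqr.
have e1 : 1 <= ln N%:R :> R.
  apply: (@le_trans _ _ (ln (2 ^ 2)%:R)).
    by rewrite ln_natX//; have := ln2_ge_half R; lra.
  rewrite ler_ln ?posrE ?ltr0n ?expn_gt0// ler_nat; apply: leq_trans lN.
  by rewrite leq_sqr; exact: leq_trans l196.
by lra.
Qed.

(** * Operator norms and the strong Kreiss constant *)

Lemma opnorm_le (R : realType) (V : normedModType R[i]) (S : V -> V) (B : R) :
  0 <= B -> (forall x, rnorm (S x) <= B * rnorm x) -> opnorm S <= B.
Proof.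
move=> B0 SB; apply: ge_sup.
  by exists (rnorm (S 0)), 0 => //=; rewrite rnorm0.
move=> _ [x /= x1 <-]; apply: le_trans (SB x) _.
by rewrite ler_piMr.
Qed.

Lemma le_opnorm (R : realType) (V : normedModType R[i]) (S : V -> V) x :
  bounded_operator S -> rnorm (S x) <= opnorm S * rnorm x.
Proof.
move=> [Slin [M SM]].
have [x0|x0] := eqVneq (rnorm x) 0.
  by rewrite (rnorm0_eq0 x0) linearT0// rnorm0 mulr0.
have xp : 0 < rnorm x by rewrite lt_neqAle eq_sym x0 rnorm_ge0.
rewrite -ler_pdivrMr//.
have -> : rnorm (S x) / rnorm x = rnorm (S ((((rnorm x)^-1)%:C)%C *: x)).
  by rewrite linearTZ// rnormZ rnormR ?invr_ge0 ?rnorm_ge0// mulrC.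
apply: ub_le_sup; last first.
  exists ((((rnorm x)^-1)%:C)%C *: x) => //=.
  by rewrite rnormZ rnormR ?invr_ge0 ?rnorm_ge0// mulVf.
exists `|M| => _ [u /= u1 <-]; apply: le_trans (SM u) _.
apply: le_trans (ler_wpM2r (rnorm_ge0 _) (ler_norm M)) _.
by rewrite ler_piMr.
Qed.

Lemma bounded_iter (R : realType) (V : normedModType R[i]) (S : V -> V) k :
  bounded_operator S -> bounded_operator (iter k S).
Proof.
move=> [Slin [M SM]]; split; first exact: linear_iter.
exists (`|M| ^+ k); apply: iter_bound => // x.
by apply: le_trans (SM x) _; rewrite ler_wpM2r ?rnorm_ge0// ler_norm.
Qed.

(** Some admissible constant lies below K + 1, whether or not the infimum is attained; the absolute
    value makes the bound at least 1 as well. *)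
Lemma strongly_kreiss_resolvents (R : realType) (V : normedModType R[i])
  (T : V -> V) (K : R) :
  strongly_kreiss_bounded T -> strong_kreiss_constant T = K ->
  kreiss_resolvents T (`|K| + 1).
Proof.
move=> [spec [C1 C10 hC1]] hK l l1.
have [c [c0 hc] cK] : exists2 c, 0 < c /\ strong_kreiss_bound T c & c < K + 1.
  apply: (@inf_lt _ [set C | 0 < C /\ strong_kreiss_bound T C]%classic).
    by exists C1.
  by rewrite -/(strong_kreiss_constant T) hK ltrDl.
have : is_resolvent T l (resolvent T l).
  apply: getPex; apply: contrapT => nS.
  by have := spec l nS; rewrite /= leNgt l1.
move=> [Sb _ Sr]; exists (resolvent T l); split=> // k x k0.
apply: le_trans (le_opnorm _ (bounded_iter _ Sb)) _; rewrite ler_wpM2r ?rnorm_ge0//.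
apply: le_trans (hc l k l1 k0) _; rewrite ler_wpM2r ?invr_ge0 ?exprn_ge0//.
  by rewrite subr_ge0 ltW.
by rewrite (le_trans (ltW cK))// lerD2r ler_norm.
Qed.

(** * Iteration over the scales, with uniform constants *)

Section growth.
Context {R : realType} (p L : R).
Hypothesis p1 : 1 < p.
Hypothesis L1 : 1 <= L.

Let p0 : 0 < p. Proof. by move: p1; lra. Qed.
Let L0 : 0 <= L. Proof. exact: le_trans ler01 L1. Qed.
Let L16 : 1 <= 16 * L. Proof. by move: L1; lra. Qed.

(** This is p max(1/p, 1 - 1/p), the exponent of the gluing cost after taking p-th powers. *)
Let sigma : R := 1 + Num.max 0 (p - 2).

Let sigma1 : 1 <= sigma.
Proof. by rewrite /sigma lerDl le_max lexx. Qed.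

Let C0 (n0 : nat) : R := ((n0.*2.+1)%:R * (16 * L) ^+ n0.*2) `^ p.

Let Phi (n0 kap n : nat) : R := C0 n0 * n%:R `^ sigma * (1 + ln n%:R) ^+ kap.

Let C0_mono m n : (m <= n)%N -> C0 m <= C0 n.
Proof.
have L16' : 0 <= 16 * L := le_trans ler01 L16.
move=> mn; apply: (ge0_ler_powR (ltW p0)).
- by rewrite nnegrE mulr_ge0// exprn_ge0.
- by rewrite nnegrE mulr_ge0// exprn_ge0.
- rewrite ler_pM ?exprn_ge0//; first by rewrite ler_nat ltnS leq_double.
  by rewrite ler_weXn2l// leq_double.
Qed.

Let ln_nat_ge0 n : 0 <= ln n%:R :> R.
Proof. by case: n => [|n]; [rewrite ln0|rewrite ln_ge0// ler1n]. Qed.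

(** Strong induction from 14 l to n, l the integer square root of n. With l + 5 <= 2 l, the step
    yields (2 l)^sigma (14 l)^sigma <= 28^sigma n^sigma, and the contraction (7/8)^kap of the
    logarithmic factor pays for (8 L)^p 28^sigma. Scales with l < 196 fall under [level_base], with
    16 L as norm bound. *)
Lemma level_growth (V : normedModType R[i]) (T : V -> V) (kap n : nat) :
  linear T -> kreiss_resolvents T L ->
  (exists M : R, forall x, rnorm (T x) <= M * rnorm x) -> lp_extension V p ->
  (8 * L) `^ p * 28%:R `^ sigma * (7 / 8) ^+ kap <= 1 ->
  (0 < n)%N -> level T p n (Phi (197 ^ 2) kap n).
Proof.
move=> Tlin TL Tb Vext hkap.
set n0 := (197 ^ 2)%N; have hn0 : (197 ^ 2 <= n0)%N by rewrite leqnn.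
clearbody n0.
have TW := weight_exists Tlin L1 TL Tb.
have TM := kreiss_norm_bound Tlin L1 TL Tb.
elim/ltn_ind: n => n IH n_gt0.
have [l /[dup] lnl /andP[sqn nsq]] := nat_sqrt n.
have n1 : 1 <= n%:R :> R by rewrite ler1n.
have [l196|l196] := ltnP l 196.
  apply: level_le (level_base p1 n L16 TM) => //.
  have nn0 : (n <= n0)%N.
    by apply: leq_trans hn0; apply: leq_trans (ltnW nsq) _; rewrite leq_sqr ltnW.
  apply: le_trans (C0_mono nn0) _.
  rewrite /Phi -mulrA ler_peMr ?powR_ge0// -[leLHS]mulr1 ler_pM//.
    rewrite -[leLHS](powRr0 n%:R); apply: ler_powR => //.
    exact: le_trans sigma1.
  by rewrite exprn_ege1// lerDl.
have l0 : (0 < l)%N by exact: leq_trans l196.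
have ltn : (14 * l < n)%N.
  by apply: leq_trans sqn; rewrite -mulnn ltn_mul2r l0; exact: leq_trans l196.
have Phi0 m : 0 <= Phi n0 kap m.
  by rewrite !mulr_ge0 ?powR_ge0// exprn_ge0// addr_ge0.
have l21 : (21 <= l)%N by exact: leq_trans l196.
have := level_step Tlin p1 L1 Vext TW l21 lnl (Phi0 (14 * l)%N)
  (IH _ ltn ltac:(by rewrite muln_gt0)).
apply: level_le.
have lc := log_contraction R l196 sqn.
rewrite /Phi -/sigma.
apply: (@le_trans _ _ ((8 * L) `^ p * (2 * l)%:R `^ sigma *
    (C0 n0 * (14 * l)%:R `^ sigma * (7 / 8 * (1 + ln n%:R)) ^+ kap))).
  rewrite ler_pM ?mulr_ge0 ?powR_ge0 ?exprn_ge0 ?addr_ge0//.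
    rewrite ler_wpM2l ?powR_ge0//.
    apply: ge0_ler_powR; rewrite ?nnegrE//; first exact: le_trans sigma1.
    rewrite ler_nat mul2n -addnn leq_add2l; exact: leq_trans l21.
  rewrite ler_wpM2l ?mulr_ge0 ?powR_ge0// lerXn2r ?nnegrE ?addr_ge0//.
  by rewrite mulr_ge0// addr_ge0.
rewrite exprMn.
have e : (2 * l)%:R `^ sigma * (14 * l)%:R `^ sigma = 28%:R `^ sigma * (l ^ 2)%:R `^ sigma :> R.
  rewrite -!powRM// -!natrM; congr (_%:R `^ _).
  by rewrite mulnACA mulnn.
have ll : (l ^ 2)%:R `^ sigma <= n%:R `^ sigma :> R.
  by apply: ge0_ler_powR; rewrite ?nnegrE ?ler_nat//; exact: le_trans sigma1.
set X := (1 + ln n%:R) ^+ kap.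
have X0 : 0 <= X by rewrite exprn_ge0// addr_ge0.
have -> : (8 * L) `^ p * (2 * l)%:R `^ sigma *
    (C0 n0 * (14 * l)%:R `^ sigma * ((7 / 8) ^+ kap * X)) =
  ((8 * L) `^ p * 28%:R `^ sigma * (7 / 8) ^+ kap) * (C0 n0 * (l ^ 2)%:R `^ sigma * X).
  transitivity ((8 * L) `^ p * (7 / 8) ^+ kap * C0 n0 * X *
     ((2 * l)%:R `^ sigma * (14 * l)%:R `^ sigma)); first by ring.
  by rewrite e; ring.
apply: (@le_trans _ _ (1 * (C0 n0 * (l ^ 2)%:R `^ sigma * X))).
  by rewrite ler_wpM2r ?mulr_ge0 ?powR_ge0.
by rewrite mul1r ler_wpM2r// ler_wpM2l ?powR_ge0.
Qed.

(** The exponent of [l] in Lam^(2/p): dividing by l, about sqrt N, leaves l^(2 tau), at most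
    N^tau. *)
Lemma sigma_tau : sigma * (2 / p) = 1 + `|2^-1 - p^-1| * 2.
Proof.
have pn0 : p != 0 by rewrite gt_eqF.
rewrite /sigma; have [p2|p2] := leP p 2.
  rewrite max_l; last by rewrite subr_le0.
  rewrite ler0_norm; first by field.
  by rewrite subr_le0 lef_pV2 ?posrE.
rewrite max_r; last by rewrite subr_ge0 ltW.
rewrite ger0_norm; first by field.
by rewrite subr_ge0 lef_pV2 ?posrE// ltW.
Qed.

Lemma power_growth : exists C kappa : R, [/\ 0 < C, 0 < kappa &
  forall (V : normedModType R[i]) (T : V -> V),
  linear T -> kreiss_resolvents T L ->
  (exists M : R, forall x, rnorm (T x) <= M * rnorm x) -> lp_extension V p ->
  forall (N : nat) (x : V), (1 <= N)%N ->
    rnorm (iter N T x) <=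
      C * N%:R `^ `|2^-1 - p^-1| * ln (N.+1)%:R `^ kappa * rnorm x].
Proof.
set tau := `|_|; have tau0 : 0 <= tau by exact: normr_ge0.
have [kap [kap0 hkap]] := @geometric_small R ((8 * L) `^ p * 28%:R `^ sigma)
  ltac:(by rewrite mulr_ge0 ?powR_ge0).
pose n0 := (197 ^ 2)%N.
(* [level_power_bound] raises the logarithmic factor (1 + ln)^kap to the power 2/p. *)
pose kappa : R := kap%:R * (2 / p).
have kappa0 : 0 < kappa by rewrite mulr_gt0 ?ltr0n// divr_gt0.
(* [A] covers N below 197^2 by the crude norm bound, [B] the larger N. The factor 3^kappa in the
   final constant comes from 1 + ln N <= 3 ln (N + 1). *)
pose A : R := (16 * L) ^+ n0.
pose B : R := 4 * L * (C0 n0 `^ (2 / p) * 14%:R `^ (1 + tau * 2)).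
have A0 : 0 < A by rewrite exprn_gt0// (lt_le_trans ltr01).
have B0 : 0 <= B by rewrite !mulr_ge0 ?powR_ge0.
exists ((A + B) * 3%:R `^ kappa), kappa; split=> //.
  by rewrite mulr_gt0 ?powR_gt0// ltr_wpDr.
move=> V T Tlin TL Tb Vext N x N1.
have NR1 : 1 <= N%:R :> R by rewrite ler1n.
have ln1 : 2^-1 <= ln N.+1%:R :> R.
  by apply: le_trans (ln2_ge_half R) _; rewrite ler_ln ?posrE ?ltr0n// ler_nat.
have lnN : 0 <= ln N.+1%:R :> R by exact: ln_nat_ge0.
have ln3 : 1 + ln N%:R <= 3%:R * ln N.+1%:R :> R.
  have : ln N%:R <= ln N.+1%:R :> R by rewrite ler_ln ?posrE ?ltr0n// ler_nat.
  by lra.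
have -> : (A + B) * 3%:R `^ kappa * N%:R `^ tau * ln N.+1%:R `^ kappa * rnorm x =
    (A + B) * N%:R `^ tau * (3%:R * ln N.+1%:R) `^ kappa * rnorm x.
  by rewrite powRM//; ring.
set X := (3%:R * _) `^ kappa.
have Nt : 1 <= N%:R `^ tau by rewrite -[leLHS](powRr0 N%:R); apply: ler_powR.
have [l /[dup] lNl /andP[lN Nl]] := nat_sqrt N.
have X1 : (1 + ln N%:R) `^ kappa <= X.
  by apply: (ge0_ler_powR (ltW kappa0)); rewrite ?nnegrE ?addr_ge0 ?mulr_ge0.
have [l196|l196] := ltnP l 196.
  have Nn0 : (N <= n0)%N by apply: leq_trans (ltnW Nl) _; rewrite leq_sqr ltnW.
  apply: le_trans (iter_bound _ (kreiss_norm_bound Tlin L1 TL Tb) N x) _.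
    exact: le_trans L16.
  rewrite ler_wpM2r ?rnorm_ge0//.
  apply: (@le_trans _ _ ((A + B) * 1 * 1)).
    rewrite !mulr1; apply: (@le_trans _ _ A); last by rewrite lerDl.
    by rewrite ler_weXn2l.
  have AB : 0 <= A + B by rewrite addr_ge0// ltW.
  rewrite ler_pM ?mulr1//; first by rewrite -[leLHS]mulr1 ler_wpM2l.
  have one : 1 = 1 `^ kappa :> R by rewrite powR1.
  apply: le_trans X1; rewrite [leLHS]one.
  by apply: (ge0_ler_powR (ltW kappa0)); rewrite ?nnegrE ?addr_ge0// lerDl.
have l0 : (0 < l)%N by exact: leq_trans l196.
have lR0 : 0 < l%:R :> R by rewrite ltr0n.
have l42 : (42 <= l)%N by exact: leq_trans l196.
have lev := level_growth (n := (14 * l)%N) Tlin TL Tb Vext hkap ltac:(by rewrite muln_gt0).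
have Phi0 : 0 <= Phi n0 kap (14 * l).
  by rewrite !mulr_ge0 ?powR_ge0// exprn_ge0// addr_ge0.
have := level_power_bound Tlin p1 L1 (weight_exists Tlin L1 TL Tb) x l42 lNl Phi0 lev.
have -> : Phi n0 kap (14 * l) `^ (2 / p) =
    C0 n0 `^ (2 / p) * 14%:R `^ (1 + tau * 2) * (l%:R * (l ^ 2)%:R `^ tau) *
    (1 + ln (14 * l)%:R) `^ kappa.
  rewrite /Phi powRM ?mulr_ge0 ?powR_ge0 ?exprn_ge0 ?addr_ge0//.
  rewrite powRM ?powR_ge0// -powRrM sigma_tau -/tau.
  rewrite -(powR_mulrn kap) ?addr_ge0// -powRrM -/kappa.
  rewrite natrM powRM// natrX -(powR_mulrn 2) ?(ltW lR0)// -powRrM.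
  rewrite [l%:R `^ (1 + _)]powRD; last by apply/implyP => _; rewrite gt_eqF.
  by rewrite powRr1 ?(ltW lR0)// [2%:R * tau]mulrC !mulrA.
move=> h.
have ltau : (l ^ 2)%:R `^ tau <= N%:R `^ tau.
  by apply: (ge0_ler_powR tau0); rewrite ?nnegrE ?ler_nat.
have lX : (1 + ln (14 * l)%:R) `^ kappa <= X.
  apply: le_trans X1; apply: (ge0_ler_powR (ltW kappa0)); rewrite ?nnegrE ?addr_ge0//.
  apply: le_trans (log_contraction R l196 lN) _.
  by rewrite ler_piMl ?addr_ge0//; lra.
have l2 : 0 < l%:R / 2 :> R by rewrite divr_gt0.
rewrite -(ler_pM2l l2); apply: le_trans h _.
rewrite [leRHS]mulrA ler_wpM2r ?rnorm_ge0//.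
apply: (@le_trans _ _ (l%:R / 2 * (B * (l ^ 2)%:R `^ tau * (1 + ln (14 * l)%:R) `^ kappa))).
  by rewrite /B; apply: ler_eq; field.
rewrite ler_wpM2l ?(ltW l2)// ler_pM ?mulr_ge0 ?powR_ge0//.
by rewrite ler_pM ?powR_ge0// lerDr ltW.
Qed.

End growth.

Theorem theorem1p1 (R : realType) (p : R) (hp : 1 < p) (K : R) :
  exists C kappa : R, [/\ 0 < C, 0 < kappa &
    forall (d : measure_display) (M : measurableType d)
      (mu : {sigma_finite_measure set M -> \bar R})
      (T : Lp mu (ltW hp) -> Lp mu (ltW hp)),
    bounded_operator T -> strongly_kreiss_bounded T ->
    strong_kreiss_constant T = K ->
    forall N : nat, (1 <= N)%N ->
      opnorm (iter N T) <=
        C * N%:R `^ `|2^-1 - p^-1| * ln (N.+1)%:R `^ kappa].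
Proof.
have L1 : 1 <= `|K| + 1 by rewrite lerDr.
(* The constants are fixed before the measure space and the operator are introduced, hence depend on
   [p] and [K] only. *)
have [C [kappa [C0 kappa0 h]]] := power_growth hp L1.
exists C, kappa; split=> // d M mu T [Tlin Tb] Tsk TK N N1.
apply: opnorm_le => [|x].
  by rewrite !mulr_ge0 ?powR_ge0// ltW.
apply: h => //; first exact: strongly_kreiss_resolvents.
exact: Lp_lp_extension.
Qed.
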